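(* Let $(x^*,y^*,u^*,v^* )$ be a local solution of the combined program (CP) described in the context, and suppose that the value function $V$ is Lipschitz continuous around $x^*$. Suppose that the rank of the matrix $$J^*=\begin{bmatrix}\nabla(\nabla_yf+u^*\nabla_yg+v^*\nabla_yh)(x^*,y^* )&\nabla_yh(x^*,y^* )^T&\nabla_yg_{\mathcal{I}^*\cup\mathcal{J}^*}(x^*,y^* )^T\\ \nabla h(x^*,y^* )&0&0\\ \nabla H(x^*,y^* )&0&0\\ \nabla g_{\mathcal{I}^*}(x^*,y^* )&0&0\end{bmatrix}$$ is equal to $d+s+m+n-|\mathcal{K}^*|$. Then RCPLD holds at $(x^*,y^*,u^*,v^* )$ for the constraint system of (CP), and $(x^*,y^*,u^*,v^* )$ is an M-stationary point of (CP). Moreover, for some $\mu\ge0$, $(x^*,y^*,u^*,v^* )$ is a local optimal solution of the penalized problem $$\min_{x,y,u,v}\ F(x,y)+\mu\,\phi_{CP}(x,y,u,v),$$ where $$\phi_{CP}(x,y,u,v)=(f(x,y)-V(x))_++\|H(x,y)\|+\|h(x,y)\|+\|G_+(x,y)\|+\|\nabla_yL(x,y,u,v)\|+\sum_{i=1}^m d_\Omega(-g_i(x,y),u_i).$$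
   Context: Combined program. $F:\mathbb{R}^d\times\mathbb{R}^s\to\mathbb{R}$ is locally Lipschitz; $G:\mathbb{R}^d\times\mathbb{R}^s\to\mathbb{R}^p$, $H:\mathbb{R}^d\times\mathbb{R}^s\to\mathbb{R}^q$ are continuously differentiable; $f:\mathbb{R}^d\times\mathbb{R}^s\to\mathbb{R}$, $g:\mathbb{R}^d\times\mathbb{R}^s\to\mathbb{R}^m$, $h:\mathbb{R}^d\times\mathbb{R}^s\to\mathbb{R}^n$ are continuously differentiable and their partial derivatives in $y$ are continuously differentiable in $(x,y)$. $Y(x)=\{y:g(x,y)\le0,\ h(x,y)=0\}$, $V(x)=\inf_{y\in Y(x)}f(x,y)$. With $\nabla_yL(x,y,u,v)=\nabla_yf(x,y)+\nabla_yg(x,y)^Tu+\nabla_yh(x,y)^Tv$ and $\Omega^m=\{(a,b)\in\mathbb{R}^m\times\mathbb{R}^m:0\le a\perp b\ge0\}$, (CP) is: minimize $F(x,y)$ over $(x,y,u,v)\in\mathbb{R}^d\times\mathbb{R}^s\times\mathbb{R}^m\times\mathbb{R}^n$ subject to $f(x,y)-V(x)\le0$, $G(x,y)\le0$, $H(x,y)=0$, $h(x,y)=0$, $\nabla_yL(x,y,u,v)=0$, $(-g(x,y),u)\in\Omega^m$. Notation: $u\nabla_yg=\sum_iu_i\nabla_yg_i$, $v\nabla_yh=\sum_jv_j\nabla_yh_j$; $\nabla(\cdot)$ without subscript is the derivative (Jacobian) with respect to $(x,y)$; $g_{\mathcal{A}}$ is the subvector of components in $\mathcal{A}$; $t_+=\max\{0,t\}$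 componentwise; $\Omega=\Omega^1$; $d_\Omega$ is the distance to $\Omega$; $\|\cdot\|$ any norm. Index sets at $(x^*,y^*,u^*,v^* )$: $I_G^*=\{i:G_i(x^*,y^* )=0\}$, $\mathcal{I}^*=\{i:g_i(x^*,y^* )=0,u_i^*>0\}$, $\mathcal{J}^*=\{i:g_i(x^*,y^* )=0,u_i^*=0\}$, $\mathcal{K}^*=\{i:g_i(x^*,y^* )<0,u_i^*=0\}$. The limiting subdifferential of a locally Lipschitz $\varphi$ is $\partial\varphi(z)=\{\lim\xi_k:\xi_k\in\widehat\partial\varphi(z_k),\ z_k\to z\}$ with $\widehat\partial\varphi(z)=\{\zeta:\varphi(z')-\varphi(z)-\langle\zeta,z'-z\rangle\ge o(\|z'-z\|)\}$. RCPLD for (CP). Write $z=(x,y,u,v)$, $z^*=(x^*,y^*,u^*,v^* )$ and regard all functions as functions of $z$. The inequality constraints are $\theta_0(z)=f(x,y)-V(x)\le 0$ (active at every feasible point) and $\theta_i(z)=G_i(x,y)\le0$, $i=1,\dots,p$, with active set $I_\theta^*=\{0\}\cup I_G^*$; the equality constraints $e_j(z)=0$, $j=1,\dots,M$, are all components of $H(x,y)=0$, $h(x,y)=0$, $\nabla_yL(z)=0$; the complementarity functions are $\mathcal{G}_i(z)=-g_i(x,y)$, $\mathcal{H}_i(z)=u_i$. RCPLD holds at $z^*$ if: (i) $\{\nabla e_j(z)\}_{j=1}^M\cup\{\nabla\mathcal{G}_i(z)\}_{i\in\mathcal{I}^*}\cup\{\nabla\mathcal{H}_i(z)\}_{i\in\mathcal{K}^*}$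 has the same rank for all $z$ near $z^*$; (ii) let $\mathcal{I}_1\subseteq\{1,\dots,M\}$, $\mathcal{I}_2\subseteq\mathcal{I}^*$, $\mathcal{I}_3\subseteq\mathcal{K}^*$ index a basis (at $z^*$) of the span of the vectors in (i) at $z^*$. For any $\mathcal{I}_4\subseteq I_\theta^*$, $\mathcal{I}_5,\mathcal{I}_6\subseteq\mathcal{J}^*$: whenever there are $w_i^*\in\partial\theta_i(z^* )$ ($i\in\mathcal{I}_4$) and multipliers $\lambda_i\ge0$ ($i\in\mathcal{I}_4$), $\mu_j$ ($j\in\mathcal{I}_1$), $a_i$ ($i\in\mathcal{I}_2\cup\mathcal{I}_5$), $b_i$ ($i\in\mathcal{I}_3\cup\mathcal{I}_6$), not all zero, such that (setting $a_i=0$, $b_i=0$ for other indices) for every $i\in\mathcal{J}^*$ either $a_i>0,b_i>0$ or $a_ib_i=0$, and $$0=\sum_{i\in\mathcal{I}_4}\lambda_iw_i^*+\sum_{j\in\mathcal{I}_1}\mu_j\nabla e_j(z^* )-\sum_{i\in\mathcal{I}_2\cup\mathcal{I}_5}a_i\nabla\mathcal{G}_i(z^* )-\sum_{i\in\mathcal{I}_3\cup\mathcal{I}_6}b_i\nabla\mathcal{H}_i(z^* ),$$ then for all sequences $z^k\to z^*$, $z^k\ne z^*$, and $w_i^k\in\partial\theta_i(z^k)$ with $w_i^k\to w_i^*$ ($i\in\mathcal{I}_4$), the indexed family $\{w_i^k\}_{i\in\mathcal{I}_4}\cup\{\nabla e_j(z^k)\}_{j\in\mathcal{I}_1}\cup\{\nabla\mathcal{G}_i(z^k)\}_{i\in\mathcal{I}_2\cup\mathcal{I}_5}\cup\{\nabla\mathcal{H}_i(z^k)\}_{i\in\mathcal{I}_3\cup\mathcal{I}_6}$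 is linearly dependent for all sufficiently large $k$. M-stationarity of a feasible point $z^*$ for (CP): there exist $\lambda^V\ge0$, $\lambda_i^G\ge0$ ($i\in I_G^*$), $\lambda^H\in\mathbb{R}^q$, $\lambda^h\in\mathbb{R}^n$, $\lambda^L\in\mathbb{R}^s$, $a,b\in\mathbb{R}^m$ such that $$0\in\partial F(x^*,y^* )+\lambda^V\partial(f-V)(x^*,y^* )+\sum_{i\in I_G^*}\lambda_i^G\nabla G_i(x^*,y^* )+\nabla H(x^*,y^* )^T\lambda^H+\nabla h(x^*,y^* )^T\lambda^h+\nabla_{(x,y)}(\nabla_yL)(z^* )^T\lambda^L+\sum_{i\in\mathcal{I}^*\cup\mathcal{J}^*}a_i\nabla g_i(x^*,y^* ),$$ $\nabla_yg(x^*,y^* )\lambda^L-b=0$, $\nabla_yh(x^*,y^* )\lambda^L=0$, $b_i=0$ for $i\in\mathcal{I}^*$, $a_i=0$ for $i\in\mathcal{K}^*$, and for $i\in\mathcal{J}^*$ either $a_i>0,b_i>0$ or $a_ib_i=0$ (here $f-V$ is the function $(x,y)\mapsto f(x,y)-V(x)$). *)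

(* Defs.v *)
From mathcomp Require Import all_boot all_order all_algebra.
From mathcomp Require Import all_classical all_reals all_analysis.
Set Implicit Arguments.
Unset Strict Implicit.
Unset Printing Implicit Defensive.
Import Order.TTheory GRing.Theory Num.Theory.
Import numFieldNormedType.Exports.
Local Open Scope classical_set_scope.
Local Open Scope ring_scope.

(* Vectors of R^n are row vectors.  A pair (x, y) is [row_mx x y] in
   R^(d + s), and z = (x, y, u, v) is [row_mx (row_mx x y) (row_mx u v)] in
   R^(d + s + (m + n)). *)

(** * Calculus *)

Section Calculus.
Context {R : realType}.

Definition dot {N} (u v : 'rV[R]_N) : R := \sum_j u 0 j * v 0 j.

(* Usual convention: entry (i, j) is the j-th partial derivative of the i-th
   component.  ['J] is its transpose, since it acts on row vectors. *)
Definition jac {N k} (phi : 'rV[R]_N -> 'rV[R]_k) (p : 'rV[R]_N) : 'M[R]_(k, N) :=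
  ('J phi p)^T.

Definition grad {N} (phi : 'rV[R]_N -> R) (p : 'rV[R]_N) : 'rV[R]_N :=
  \row_j 'd phi p (delta_mx 0 j).

(* The domain is finite dimensional, so continuity of the derivative can be
   tested direction by direction. *)
Definition C1 {N} {W : normedModType R} (phi : 'rV[R]_N -> W) : Prop :=
  (forall p, differentiable phi p) /\
  (forall v, continuous (fun p => 'd phi p v)).

Definition lipschitz_around {N} (phi : 'rV[R]_N -> R) (p : 'rV[R]_N) : Prop :=
  lipschitz_on phi (nbhs (p, p)).

Definition grad_y {d s} (phi : 'rV[R]_(d + s) -> R) (p : 'rV[R]_(d + s)) :
    'rV[R]_s := rsubmx (grad phi p).

Definition jac_y {d s k} (phi : 'rV[R]_(d + s) -> 'rV[R]_k)
    (p : 'rV[R]_(d + s)) : 'M[R]_(k, s) := rsubmx (jac phi p).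

Definition component {T} {k} (phi : T -> 'rV[R]_k) (i : 'I_k) (t : T) : R := phi t 0 i.

Definition regular_subdiff {N} (phi : 'rV[R]_N -> R) (z : 'rV[R]_N) :
    set 'rV[R]_N :=
  [set zeta | forall eps : R, 0 < eps -> \forall z' \near z,
     - (eps * `|z' - z|) <= phi z' - phi z - dot zeta (z' - z)].

Definition subdiff {N} (phi : 'rV[R]_N -> R) (z : 'rV[R]_N) : set 'rV[R]_N :=
  [set xi | exists zk xik : nat -> 'rV[R]_N,
     [/\ zk @ \oo --> z, xik @ \oo --> xi &
         forall k, regular_subdiff phi (zk k) (xik k)]].

Definition is_norm {k} (nu : 'rV[R]_k -> R) : Prop :=
  [/\ forall x, nu x = 0 -> x = 0,
      forall x y, nu (x + y) <= nu x + nu y &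
      forall a x, nu (a *: x) = `|a| * nu x].

Definition dist {k} (nu : 'rV[R]_k -> R) (A : set 'rV[R]_k) (w : 'rV[R]_k) : R :=
  inf [set nu (w - w') | w' in A].

Definition Omega k : set 'rV[R]_(k + k) :=
  [set w | [/\ forall i, 0 <= lsubmx w 0 i, forall i, 0 <= rsubmx w 0 i &
               dot (lsubmx w) (rsubmx w) = 0]].

End Calculus.

Arguments Omega {R} k _.

(** * RCPLD for inequality, equality and complementarity constraints *)

Section RCPLD.
Context {R : realType} {N : nat}.

(* [theta <= 0], [e = 0], [0 <= Gc _|_ Hc >= 0]; [Ith] is the active set of
   [theta]; [I], [J], [K] are the complementarity index sets.  Families of
   vectors are sequences: [free] sees repetitions, and the rank of a family is
   the dimension of its span. *)
Definition RCPLD {T E : finType} {m : nat}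
    (theta : T -> 'rV[R]_N -> R) (e : E -> 'rV[R]_N -> R)
    (Gc Hc : 'I_m -> 'rV[R]_N -> R)
    (Ith : {set T}) (I J K : {set 'I_m}) (zs : 'rV[R]_N) : Prop :=
  let fam (I1 : {set E}) (A B : {set 'I_m}) (z : 'rV[R]_N) : seq 'rV[R]_N :=
    [seq grad (e j) z | j <- enum I1] ++
    [seq grad (Gc i) z | i <- enum A] ++
    [seq grad (Hc i) z | i <- enum B] in
  (\forall z \near zs, \dim <<fam [set: E]%SET I K z>> = \dim <<fam [set: E]%SET I K zs>>)
  /\
  (forall (I1 : {set E}) (I2 I3 : {set 'I_m}),
     I2 \subset I -> I3 \subset K ->
     basis_of <<fam [set: E]%SET I K zs>> (fam I1 I2 I3 zs) ->
   forall (I4 : {set T}) (I5 I6 : {set 'I_m}),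
     I4 \subset Ith -> I5 \subset J -> I6 \subset J ->
   forall (ws : T -> 'rV[R]_N) (lam : T -> R) (mu : E -> R) (a b : 'I_m -> R),
     (forall i, i \in I4 -> subdiff (theta i) zs (ws i)) ->
     (forall i, i \in I4 -> 0 <= lam i) ->
     (forall i, i \notin I2 :|: I5 -> a i = 0) ->
     (forall i, i \notin I3 :|: I6 -> b i = 0) ->
     ~ [/\ forall i, i \in I4 -> lam i = 0, forall j, j \in I1 -> mu j = 0,
           forall i, i \in I2 :|: I5 -> a i = 0 &
           forall i, i \in I3 :|: I6 -> b i = 0] ->
     (forall i, i \in J -> (0 < a i /\ 0 < b i) \/ a i * b i = 0) ->
     0 = \sum_(i in I4) lam i *: ws i + \sum_(j in I1) mu j *: grad (e j) zs
         - \sum_(i in I2 :|: I5) a i *: grad (Gc i) zs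
         - \sum_(i in I3 :|: I6) b i *: grad (Hc i) zs ->
   forall (zk : nat -> 'rV[R]_N) (wk : T -> nat -> 'rV[R]_N),
     zk @ \oo --> zs -> (forall k, zk k != zs) ->
     (forall i, i \in I4 ->
        (forall k, subdiff (theta i) (zk k) (wk i k)) /\ wk i @ \oo --> ws i) ->
     \forall k \near \oo,
       ~~ free ([seq wk i k | i <- enum I4] ++
                fam I1 (I2 :|: I5) (I3 :|: I6) (zk k))).

End RCPLD.

(** * The combined program *)

Record combined_program (R : realType) (d s m n p q : nat) := CombinedProgram {
  upF : 'rV[R]_(d + s) -> R;
  upG : 'rV[R]_(d + s) -> 'rV[R]_p;
  upH : 'rV[R]_(d + s) -> 'rV[R]_q;
  lowf : 'rV[R]_(d + s) -> R;
  lowg : 'rV[R]_(d + s) -> 'rV[R]_m;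
  lowh : 'rV[R]_(d + s) -> 'rV[R]_n }.

Section CombinedProgram.
Context {R : realType} {d s m n p q : nat}.
Variable P : combined_program R d s m n p q.

Local Notation F := (upF P).
Local Notation G := (upG P).
Local Notation H := (upH P).
Local Notation f := (lowf P).
Local Notation g := (lowg P).
Local Notation h := (lowh P).
Local Notation Z := 'rV[R]_(d + s + (m + n)).

Definition zxy (z : Z) : 'rV[R]_(d + s) := lsubmx z.
Definition zu (z : Z) : 'rV[R]_m := lsubmx (rsubmx z).
Definition zv (z : Z) : 'rV[R]_n := rsubmx (rsubmx z).

Definition lower_feasible (x : 'rV[R]_d) : set 'rV[R]_s :=
  [set y | (forall i, g (row_mx x y) 0 i <= 0) /\ h (row_mx x y) = 0].

Definition value (x : 'rV[R]_d) : \bar R :=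
  ereal_inf [set (f (row_mx x y))%:E | y in lower_feasible x].

Definition value_lipschitz_around (x : 'rV[R]_d) : Prop :=
  (\forall x' \near x, value x' \is a fin_num) /\
  lipschitz_around (fine \o value) x.

(* f - V as a real function; meaningful where V is finite. *)
Definition gap (w : 'rV[R]_(d + s)) : R := f w - fine (value (lsubmx w)).

Definition grad_yL (w : 'rV[R]_(d + s)) (u : 'rV[R]_m) (v : 'rV[R]_n) : 'rV[R]_s :=
  grad_y f w + u *m jac_y g w + v *m jac_y h w.

Definition CP_feasible (z : Z) : Prop :=
  [/\ ((f (zxy z))%:E - value (lsubmx (zxy z)) <= 0)%E,
      (forall i, G (zxy z) 0 i <= 0) /\ H (zxy z) = 0,
      h (zxy z) = 0,
      grad_yL (zxy z) (zu z) (zv z) = 0 &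
      Omega m (row_mx (- g (zxy z)) (zu z))].

Definition CP_local_solution (zs : Z) : Prop :=
  CP_feasible zs /\
  \forall z \near zs, CP_feasible z -> F (zxy zs) <= F (zxy z).

Definition set_IG (z : Z) : {set 'I_p} := [set i | G (zxy z) 0 i == 0]%SET.
Definition set_I (z : Z) : {set 'I_m} :=
  [set i | (g (zxy z) 0 i == 0) && (0 < zu z 0 i)]%SET.
Definition set_J (z : Z) : {set 'I_m} :=
  [set i | (g (zxy z) 0 i == 0) && (zu z 0 i == 0)]%SET.
Definition set_K (z : Z) : {set 'I_m} :=
  [set i | (g (zxy z) 0 i < 0) && (zu z 0 i == 0)]%SET.

(* [None] is the constraint f - V <= 0, [Some i] is G_i <= 0. *)
Definition CP_theta (i : option 'I_p) (z : Z) : R :=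
  if i is Some i' then G (zxy z) 0 i' else gap (zxy z).

Definition CP_eq (j : 'I_q + 'I_n + 'I_s) (z : Z) : R :=
  match j with
  | inl (inl j') => H (zxy z) 0 j'
  | inl (inr j') => h (zxy z) 0 j'
  | inr j' => grad_yL (zxy z) (zu z) (zv z) 0 j'
  end.

Definition CP_RCPLD (z : Z) : Prop :=
  RCPLD CP_theta CP_eq
    (fun i z => - g (zxy z) 0 i) (fun i z => zu z 0 i)
    (None |: [set Some i | i in set_IG z])%SET (set_I z) (set_J z) (set_K z) z.

(* Multipliers are row vectors, so [lam *m A] stands for (A^T lam)^T. *)
Definition M_stationary (z : Z) : Prop :=
  let w := zxy z in
  CP_feasible z /\
  exists (lamV : R) (lamG : 'I_p -> R) (lamH : 'rV[R]_q) (lamh : 'rV[R]_n)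
         (lamL : 'rV[R]_s) (a b : 'rV[R]_m),
  [/\ 0 <= lamV /\ (forall i, i \in set_IG z -> 0 <= lamG i),
      exists xi eta, [/\ subdiff F w xi, subdiff gap w eta &
        0 = xi + lamV *: eta
            + \sum_(i in set_IG z) lamG i *: grad (component G i) w
            + lamH *m jac H w + lamh *m jac h w
            + lamL *m jac (fun w' => grad_yL w' (zu z) (zv z)) w
            + \sum_(i in set_I z :|: set_J z) a 0 i *: grad (component g i) w],
      lamL *m (jac_y g w)^T - b = 0 /\ lamL *m (jac_y h w)^T = 0,
      (forall i, i \in set_I z -> b 0 i = 0) /\
      (forall i, i \in set_K z -> a 0 i = 0) &
      forall i, i \in set_J z ->
        (0 < a 0 i /\ 0 < b 0 i) \/ a 0 i * b 0 i = 0].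

(* Rows of the Jacobian of [phi] indexed by [A]: the Jacobian of phi_A. *)
Definition jac_sub {N k} (phi : 'rV[R]_N -> 'rV[R]_k) (A : {set 'I_k})
    (w : 'rV[R]_N) : 'M[R]_(#|A|, N) :=
  rowsub (fun i : 'I_#|A| => enum_val i) (jac phi w).

Definition Jstar (z : Z) :
    'M[R]_(s + (n + (q + #|set_I z|)), (d + s) + (n + #|set_I z :|: set_J z|)) :=
  let w := zxy z in
  block_mx
    (jac (fun w' => grad_yL w' (zu z) (zv z)) w)
    (row_mx (jac_y h w)^T (rsubmx (jac_sub g (set_I z :|: set_J z) w))^T)
    (col_mx (jac h w) (col_mx (jac H w) (jac_sub g (set_I z) w)))
    0.

(* [nu k] is the norm chosen on R^k; the distance to Omega is taken in [nu 2]. *)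
Definition phi_CP (nu : forall k, 'rV[R]_k -> R) (z : Z) : R :=
  let w := zxy z in
  Num.max 0 (gap w) + nu q (H w) + nu n (h w)
  + nu p (map_mx (Num.max 0) (G w)) + nu s (grad_yL w (zu z) (zv z))
  + \sum_(i < m)
      dist (nu (1 + 1)%N) (Omega 1) (row_mx (- g w 0 i)%:M (zu z 0 i)%:M).

End CombinedProgram.

(* Main.v *)
(** The matrix [J*] has [d + s + m + n - |K*|] columns, so the rank hypothesis
    says that it has full column rank.  Equivalently, the gradients at [z*] of the
    equality constraints, of [g_i] for [i] in [I*] and of [u_i] for [i] in [K*]
    span the whole space.

    RCPLD is then immediate: a basis chosen among these gradients has as many
    elements as the dimension, so one more vector makes any family dependent.
    M-stationarity holds with [lamV = 0] and [lamG = 0], whatever the element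
    [xi] of the subdifferential of [F]: full column rank lets one solve
    [mu *m Jstar = row_mx (- xi) 0].  Finally these constraints have an injective
    joint differential at [z*] and near [z*] are bounded by a multiple of
    [phi_CP], whence the error bound [|z* - z| <= C phi_CP z]; the Lipschitz
    constant of [F] turns it into exact penalization. *)

From HB Require Import structures.
Require Import Defs.
From mathcomp Require Import all_boot all_order all_algebra.
From mathcomp Require Import all_classical all_reals all_analysis.
From mathcomp Require Import ring lra zify.
Set Implicit Arguments.
Unset Strict Implicit.
Unset Printing Implicit Defensive.
Import Order.TTheory GRing.Theory Num.Theory.
Import numFieldNormedType.Exports.
Local Open Scope classical_set_scope.
Local Open Scope ring_scope.

(** * Norms and spans in finite dimension *)

Section FiniteDimension.
Context {R : realType}.
Implicit Types N k : nat.

Lemma coord_le_norm k N (v : 'M[R]_(k, N)) i j : `|v i j| <= `|v|.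
Proof.
by rewrite [leRHS]/Num.norm /= mx_normrE; apply/bigmax_geP; right; exists (i, j).
Qed.

Lemma norm_le_coord k N (v : 'M[R]_(k, N)) (c : R) :
  0 <= c -> (forall i j, `|v i j| <= c) -> `|v| <= c.
Proof.
by move=> c0 vc; rewrite /Num.norm /= mx_normrE; apply: bigmax_le => // -[].
Qed.

Lemma dot_gradE N (phi : 'rV[R]_N -> R) p v : dot (grad phi p) v = 'd phi p v.
Proof.
rewrite [in RHS](row_sum_delta v) linear_sum /dot; apply: eq_bigr => j _.
by rewrite linearZ /= mxE mulrC.
Qed.

Lemma norm_dot_le N (u v : 'rV[R]_N) : `|dot u v| <= (\sum_j `|u 0 j|) * `|v|.
Proof.
rewrite mulr_suml (le_trans (ler_norm_sum _ _ _))//.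
apply: ler_sum => j _.
by rewrite normrM ler_wpM2l// coord_le_norm.
Qed.

(** On the kernel of [g], [f] coincides with [f - g], whose size is controlled by its values on the
    canonical basis. This serves to compare a differential with a nearby one. *)
Lemma linear_sub_le N (f g : {linear 'rV[R]_N -> R}) v : g v = 0 ->
  `|f v| <= (\sum_j `|f 'e_j - g 'e_j|) * `|v|.
Proof.
move=> gv.
have -> : f v = \sum_j v 0 j * (f 'e_j - g 'e_j).
  have linE (k : {linear 'rV[R]_N -> R}) : k v = \sum_j v 0 j * k 'e_j.
    rewrite [in LHS](row_sum_delta v) linear_sum.
    by apply: eq_bigr => j _; rewrite linearZ.
  under eq_bigr do rewrite mulrBr.
  by rewrite sumrB -!linE gv subr0.
rewrite mulr_suml (le_trans (ler_norm_sum _ _ _))//; apply: ler_sum => j _.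
by rewrite normrM mulrC ler_wpM2l// coord_le_norm.
Qed.

Lemma is_norm0 k (nu : 'rV[R]_k -> R) : is_norm nu -> nu 0 = 0.
Proof. by move=> [_ _ nuZ]; rewrite -(scale0r 0) nuZ normr0 mul0r. Qed.

Lemma is_normN k (nu : 'rV[R]_k -> R) x : is_norm nu -> nu (- x) = nu x.
Proof. by move=> [_ _ nuZ]; rewrite -scaleN1r nuZ normrN1 mul1r. Qed.

Lemma is_norm_ge0 k (nu : 'rV[R]_k -> R) x : is_norm nu -> 0 <= nu x.
Proof.
move=> nuN; have [_ nuD _] := nuN; have := nuD x (- x).
by rewrite subrr is_norm0// is_normN// => h; lra.
Qed.

(** Expand [x] in the canonical basis and apply the triangle inequality. Together with
    [is_norm_lower] this is the equivalence of [nu] with the sup norm. *)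
Lemma is_norm_upper k (nu : 'rV[R]_k -> R) :
  is_norm nu -> forall x, nu x <= (\sum_j nu 'e_j) * `|x|.
Proof.
move=> nuN x; have [_ nuD nuZ] := nuN.
rewrite [in X in X <= _](row_sum_delta x) mulr_suml.
apply: (@le_trans _ _ (\sum_j nu (x 0 j *: 'e_j))).
  elim/big_ind2 : _ => [|a b c d ab cd|//]; first by rewrite is_norm0.
  by rewrite (le_trans (nuD _ _))// lerD.
apply: ler_sum => j _; rewrite nuZ mulrC ler_wpM2l ?coord_le_norm//.
exact: is_norm_ge0.
Qed.

Lemma is_norm_continuous k (nu : 'rV[R]_k -> R) : is_norm nu -> continuous nu.
Proof.
move=> nuN x; have [_ nuD _] := nuN.
have nuB y z : nu y - nu z <= nu (y - z).
  by rewrite lerBlDr -[in leLHS](subrK z y) nuD.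
set C := \sum_j nu 'e_j.
have C0 : 0 <= C by apply: sumr_ge0 => j _; exact: is_norm_ge0.
have FF : Filter (nbhs x) by exact: nbhs_filter.
apply/cvgrPdist_le => e e0.
(* The [+ 1] keeps the divisor positive when [C] is 0, as happens in dimension 0. *)
have eC : 0 < e / (C + 1) by rewrite divr_gt0// ltr_wpDl.
have /cvgrPdist_le/(_ _ eC) : id y @[y --> x] --> x by exact: cvg_id.
apply: filterS => y /=; rewrite ler_pdivlMr ?ltr_wpDl// => xy.
apply: (@le_trans _ _ (nu (x - y))).
  by rewrite ler_norml nuB andbT lerNl opprB -(is_normN (x - y))// opprB nuB.
rewrite (le_trans (is_norm_upper nuN _))// (le_trans _ xy)// mulrC.
by rewrite ler_wpM2l// lerDl.
Qed.

(* [nu] attains a positive minimum on the compact unit sphere of the sup norm. *)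
Lemma is_norm_lower k (nu : 'rV[R]_k -> R) :
  is_norm nu -> exists2 c, 0 < c & forall x, c * `|x| <= nu x.
Proof.
move=> nuN; have [nu0 _ nuZ] := nuN.
pose S := [set x : 'rV[R]_k | `|x| = 1].
have [[x1 Sx1]|S0] := pselect (S !=set0); last first.
  (* The sphere is empty only if every vector is 0, since a nonzero one could be normalized; then
     any constant will do. *)
  exists 1 => // x; have [->|x0] := eqVneq x 0.
    by rewrite normr0 mulr0 is_norm0.
  case: S0; exists (`|x|^-1 *: x); rewrite /S /= normrZ normfV normr_id.
  by rewrite mulVf// normr_eq0.
have [c cS cmin] : exists2 c, c \in S & forall t, t \in S -> nu c <= nu t.
  apply: EVT_min_rV; first by exists x1.
    apply: bounded_closed_compact.
      exists 1; split; first exact: num_real.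
      by move=> M M1 x /= ->; exact: ltW.
    apply: (@preimage_closed _ _ (fun x : 'rV[R]_k => `|x|) [set 1]).
      by move=> x _; exact: norm_continuous.
    exact: closed_eq.
  by apply: continuous_subspaceT; exact: is_norm_continuous.
have c1 : `|c| = 1 by move: cS; rewrite inE.
exists (nu c).
  rewrite lt_neqAle is_norm_ge0// andbT eq_sym; apply/eqP => /nu0 c0.
  by move: c1; rewrite c0 normr0 => /eqP; rewrite eq_sym oner_eq0.
move=> x; have [->|x0] := eqVneq x 0; first by rewrite normr0 mulr0 is_norm0.
have nx0 : `|x| != 0 by rewrite normr_eq0.
have : nu c <= nu (`|x|^-1 *: x).
  by apply: cmin; rewrite inE /S /= normrZ normfV normr_id mulVf.
by rewrite nuZ normfV normr_id ler_pdivlMl ?normr_gt0// mulrC.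
Qed.

(** With the vectors of [r] as the rows of [M], a trivial orthogonal complement says that [M^T] has
    a trivial left kernel. Hence [M] has rank [N], and a left inverse [B] of [M] gives the
    coefficients of any [v] on the rows. *)
Lemma span_full N (r : seq 'rV[R]_N) :
  (forall v, (forall c, c \in r -> dot c v = 0) -> v = 0) -> << r >>%VS = fullv.
Proof.
move=> rorth; apply/eqP; rewrite eqEsubv subvf /=.
pose M : 'M[R]_(size r, N) := \matrix_i r`_i.
have : row_free M^T.
  apply: inj_row_free => v vM; apply: rorth => c /(nthP 0)[i ir <-].
  have := congr1 (fun A : 'rV_(size r) => A 0 (Ordinal ir)) vM.
  rewrite !mxE => <-; apply: eq_bigr => j _.
  by rewrite !mxE mulrC.
rewrite /row_free mxrank_tr -/(row_full M) => /row_fullP[B BM].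
apply/subvP => v _; rewrite -[v]mulmx1 -BM mulmxA mulmx_sum_row.
apply: memv_suml => i _; apply: memvZ; rewrite rowK.
by apply/memv_span/mem_nth.
Qed.

End FiniteDimension.

(** * Finite families of functions with injective joint differential *)

Section Gradients.
Context {R : realType} {N : nat} {T : finType}.
Variables (phi : T -> 'rV[R]_N -> R) (r : seq T) (zs : 'rV[R]_N).

(** This is the full-rank condition on the gradients, stated through the kernel so that no Jacobian
    of the whole family has to be assembled. *)
Definition injective_diff (z : 'rV[R]_N) : Prop :=
  forall v, (forall t, t \in r -> 'd (phi t) z v = 0) -> v = 0.

(** Injectivity is exactly what makes the right-hand sum a norm in [v], and all norms are equivalent
    in finite dimension. *)
Lemma injective_diff_lower : injective_diff zs ->
  exists2 c, 0 < c & forall v, c * `|v| <= \sum_(t <- r) `|'d (phi t) zs v|.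
Proof.
move=> inj; apply: is_norm_lower; split => [x x0|x y|a x].
- apply: inj => t tr; apply/eqP; move: x0 => /eqP.
  by rewrite psumr_eq0// => /allP/(_ _ tr); rewrite /= normr_eq0.
- by rewrite -big_split; apply: ler_sum => t _; rewrite linearD ler_normD.
- by rewrite mulr_sumr; apply: eq_bigr => t _; rewrite linearZ normrM.
Qed.

Lemma span_grad_full z :
  injective_diff z -> <<[seq grad (phi t) z | t <- r]>>%VS = fullv.
Proof.
move=> inj; apply: span_full => v rv; apply: inj => t tr.
by rewrite -dot_gradE; apply: rv; exact: map_f.
Qed.

(** [S z] measures how far the differentials at [z] are from those at [zs]. A vector [v] killed at
    [z] satisfies [c |v| <= S z |v|], and [S z < c] near [zs] by continuity, so [v = 0]. *)
Lemma near_injective_diff : (forall t, C1 (phi t)) ->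
  injective_diff zs -> \forall z \near zs, injective_diff z.
Proof.
move=> phiC1 /injective_diff_lower[c c0 cP].
pose S z : R := \sum_(t <- r) \sum_j `|'d (phi t) zs 'e_j - 'd (phi t) z 'e_j|.
have S0 : S z @[z --> zs] --> S zs.
  have FF : Filter (nbhs zs) by exact: nbhs_filter.
  have addc : continuous (fun x : R * R => x.1 + x.2) by exact: add_continuous.
  rewrite /S; apply: (@cvg_big _ _ _ _ _ addc _ (nbhs zs)) => t _.
  apply: (@cvg_big _ _ _ _ _ addc _ (nbhs zs)) => j _.
  apply: (@cvg_norm _ _ _ (nbhs zs)).
  apply: (@cvgB _ _ _ (nbhs zs)); first exact: cvg_cst.
  exact: (phiC1 t).2.
have Szs : S zs = 0.
  rewrite /S big1// => t _; rewrite big1// => j _.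
  by rewrite subrr normr0.
rewrite Szs in S0.
move: S0 => /cvgrPdist_lt/(_ _ c0); apply: filterS => z.
rewrite sub0r normrN => /(le_lt_trans (ler_norm _)) Szc v zv.
apply/eqP; rewrite -normr_le0 leNgt; apply/negP => v0.
suff : c * `|v| <= S z * `|v| by rewrite ler_pM2r// leNgt Szc.
rewrite (le_trans (cP v))// mulr_suml big_seq [leRHS]big_seq.
apply: ler_sum => t tr.
exact: linear_sub_le (zv _ tr).
Qed.

(** The lower bound [c |z - zs|] on the differentials carries over to the increments of the
    functions: the first-order remainders add up to at most half of it and are absorbed. *)
Lemma injective_diff_error_bound : (forall t, differentiable (phi t) zs) ->
  injective_diff zs -> exists2 C, 0 < C &
  \forall z \near zs, `|z - zs| <= C * \sum_(t <- r) `|phi t z - phi t zs|.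
Proof.
move=> dphi /injective_diff_lower[c c0 cP].
(* Summing [eps] over [r] gives at most [c / 2]; the successor avoids division by 0 for empty
   [r]. *)
pose eps := c / 2 / (size r).+1%:R.
have eps0 : 0 < eps by rewrite !divr_gt0.
exists (2 / c); first by rewrite divr_gt0.
have dphiz t : \forall z \near zs,
    `|phi t z - phi t zs - 'd (phi t) zs (z - zs)| <= eps * `|z - zs|.
  have [[_ +]] := dphi t; rewrite lim_id// => /eqaddoP/(_ _ eps0).
  apply: filterS => z; congr (`|_| <= _).
  by rewrite /= !fctE opprD addrA.
have FF : Filter (nbhs zs) by exact: nbhs_filter.
have := filter_forall FF dphiz; apply: filterS => z zP.
rewrite mulrC -ler_pdivrMr ?divr_gt0// invf_div.
have : c * `|z - zs| <= \sum_(t <- r) `|phi t z - phi t zs| + c / 2 * `|z - zs|.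
  rewrite (le_trans (cP _))//.
  apply: (@le_trans _ _ (\sum_(t <- r) (`|phi t z - phi t zs| + eps * `|z - zs|))).
    apply: ler_sum => t _; rewrite -lerBlDl (le_trans _ (zP t))//.
    by rewrite [leRHS]distrC lerB_dist.
  rewrite big_split lerD2l big_const_seq count_predT iter_addr_0.
  rewrite -mulrnAl ler_wpM2r// -mulr_natr /eps -[leLHS]mulrA ger_pMr ?divr_gt0//.
  by rewrite mulrC ler_pdivrMr// mul1r ler_nat.
by move=> h; lra.
Qed.

End Gradients.

(** * Nonemptiness of the limiting subdifferential *)

Section Subdifferential.
Context {R : realType} {N : nat}.
Implicit Types (phi : 'rV[R]_N -> R) (z v h : 'rV[R]_N).

Lemma lipschitz_aroundP phi z : lipschitz_around phi z ->
  exists L r : R, [/\ 0 < L, 0 < r & forall x y, `|z - x| < r -> `|z - y| < r ->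
    `|phi x - phi y| <= L * `|x - y|].
Proof.
move=> /(@pinfty_ex_gt0 _ _)[L L0 [[A B] /= [/nbhs_ballP[r1 /= r10 rA]
  /nbhs_ballP[r2 /= r20 rB]] AB]].
exists L, (Num.min r1 r2); split => //; first by rewrite lt_min r10.
move=> x y; rewrite !lt_min => /andP[x1 _] /andP[_ y2].
have := AB (x, y); apply; split => /=; [apply: rA|apply: rB];
  by rewrite -ball_normE.
Qed.

(** The norm on the left is the sup norm, and each squared coordinate is one term of the Euclidean
    square. *)
Lemma sqr_norm_le_dot v : `|v| ^+ 2 <= dot v v.
Proof.
have vv0 : 0 <= dot v v by apply: sumr_ge0 => j _; rewrite -expr2 sqr_ge0.
rewrite -(sqr_sqrtr vv0) ler_pXn2r ?nnegrE ?sqrtr_ge0//.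
apply: norm_le_coord; first exact: sqrtr_ge0.
move=> i j; rewrite ord1 -sqrtr_sqr ler_wsqrtr//.
rewrite /dot (bigD1 j)//= -expr2 lerDl.
by apply: sumr_ge0 => l _; rewrite -expr2 sqr_ge0.
Qed.

Lemma dotDD v h : dot (v + h) (v + h) = dot v v + 2 * dot v h + dot h h.
Proof.
rewrite /dot mulr_sumr -!big_split; apply: eq_bigr => j _.
by rewrite /= !mxE; ring.
Qed.

Lemma dotZl a v h : dot (a *: v) h = a * dot v h.
Proof.
by rewrite /dot mulr_sumr; apply: eq_bigr => j _; rewrite !mxE mulrA.
Qed.

(* Minimize [phi + K |. - z0|^2] on a small closed ball around [z0]: for [K]
   large, the Lipschitz bound forces the minimizer into the interior. *)
Lemma lipschitz_regular_subdiff_near phi z0 (L r e : R) :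
  0 < L -> 0 < r -> 0 < e ->
  (forall x y, `|z0 - x| < r -> `|z0 - y| < r ->
    `|phi x - phi y| <= L * `|x - y|) ->
  exists z zeta, [/\ `|z0 - z| <= e, `|zeta| <= 2 * L & regular_subdiff phi z zeta].
Proof.
move=> L0 r0 e0 phiL.
pose rho := Num.min r e / 2.
have rho0 : 0 < rho by rewrite divr_gt0// lt_min r0.
have rhor : rho < r.
  by rewrite (lt_le_trans (_ : _ < Num.min r e))// ?ge_min ?lexx// /rho gtr_pMr
     ?lt_min ?r0// invf_lt1// ltr1n.
have rhoe : rho <= e.
  rewrite (le_trans (_ : _ <= Num.min r e))// ?ge_min ?lexx ?orbT// /rho ger_pMr
     ?lt_min ?r0// invf_le1// ler1n//.
(* Since [K * rho = L + rho > L], the bound [K |v| <= L] proved below puts the minimizer strictly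
   inside the ball. *)
pose K := L / rho + 1.
have K0 : 0 < K by rewrite addr_gt0// divr_gt0.
pose A := [set z : 'rV[R]_N | `|z0 - z| <= rho].
pose psi z := phi z + K * dot (z - z0) (z - z0).
have contn (c : 'rV[R]_N) : continuous (fun z : 'rV[R]_N => `|c - z|).
  move=> x; apply: (@cvg_norm _ _ _ (nbhs x)).
  by apply: (@cvgB _ _ _ (nbhs x)); [exact: cvg_cst|exact: cvg_id].
have [z zA zmin] : exists2 z, z \in A & forall t, t \in A -> psi z <= psi t.
  apply: EVT_min_rV; first by exists z0; rewrite /A/= subrr normr0 ltW.
    apply: bounded_closed_compact.
      exists (`|z0| + rho); split; first exact: num_real.
      move=> M MA x /= xA; rewrite -[x](subKr z0) (le_trans (ler_normB _ _))//.
      by rewrite (le_trans _ (ltW MA))// lerD2l.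
    apply: (@preimage_closed _ _ (fun z => `|z0 - z|) [set x | x <= rho]).
      by move=> x _; exact: contn.
    exact: closed_le.
  apply: continuous_in_subspaceT => x; rewrite inE /A /= => xA.
  have FF : Filter (nbhs x) by exact: nbhs_filter.
  apply: (@cvgD _ _ _ (nbhs x)).
    suff : phi y @[y --> x] --> phi x by [].
    apply/cvgrPdist_le => d d0.
    have x0r : \forall y \near x, `|z0 - y| < r.
      have := contn z0 x => /cvgr_lt/(_ r); apply.
      exact: le_lt_trans xA rhor.
    have xyd : \forall y \near x, `|x - y| < d / L.
      by have := contn x x => /cvgr_lt/(_ (d / L)); apply;
         rewrite subrr normr0 divr_gt0.
    near=> y; rewrite (le_trans (phiL _ _ _ _))//.
    - exact: le_lt_trans xA rhor.
    - by near: y.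
    - rewrite -ler_pdivlMl// mulrC ltW//; near: y.
      exact: xyd.
  apply: (@cvgM _ _ (nbhs x)); first exact: cvg_cst.
  have addc : continuous (fun x : R * R => x.1 + x.2) by exact: add_continuous.
  apply: (@cvg_big _ _ _ _ _ addc _ (nbhs x)) => j _.
  have cj : (y - z0) 0 j @[y --> x] --> (x - z0) 0 j.
    have -> : (fun y : 'rV[R]_N => (y - z0) 0 j) = (fun y => y 0 j - z0 0 j).
      by apply/funext => y; rewrite !mxE.
    rewrite !mxE; apply: (@cvgB _ _ _ (nbhs x)); last exact: cvg_cst.
    exact: coord_continuous.
  exact: (@cvgM _ _ (nbhs x)).
pose v := z - z0.
have {zA} vrho : `|v| <= rho by move: zA; rewrite inE /A /= distrC.
(* Comparing the minimizer with the centre gives [K |v|^2 <= phi z0 - phi z <= L |v|]. *)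
have KL : K * `|v| <= L.
  have [->|v0] := eqVneq `|v| 0; first by rewrite mulr0 ltW.
  have nv0 : 0 < `|v| by rewrite lt_neqAle eq_sym v0 normr_ge0.
  rewrite -(ler_pM2r nv0) -mulrA -expr2.
  have : psi z <= psi z0.
    by apply: zmin; rewrite inE /A /= subrr normr0 ltW.
  rewrite /psi subrr -/v /dot [X in _ <= _ + _ * X]big1 ?mulr0 ?addr0; last first.
    by move=> j _; rewrite mxE mul0r.
  rewrite -/(dot v v) => psiz.
  have := phiL z0 z; rewrite subrr normr0 => /(_ r0).
  rewrite distrC -/v => /(_ (le_lt_trans vrho rhor)) /ler_normlP[_ phiz].
  have := ler_wpM2l (ltW K0) (sqr_norm_le_dot v).
  by move=> h; lra.
have vltrho : `|v| < rho.
  rewrite -(ltr_pM2l K0) (le_lt_trans KL)// /K mulrDl mul1r divfK ?gt_eqF//.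
  by rewrite ltrDl.
(* The regular subgradient is minus the gradient at [z] of the quadratic term; its norm is
   [2 K |v| <= 2 L]. *)
exists z, (- (2 * K) *: v); split.
- by rewrite distrC (le_trans vrho).
- have K20 : 0 <= 2 * K by rewrite mulr_ge0// ltW.
  by rewrite normrZ normrN ger0_norm// -mulrA ler_pM2l.
move=> eps eps0.
have near1 : \forall z' \near z, `|z0 - z'| < rho.
  have := contn z0 z => /cvgr_lt/(_ rho); apply.
  by rewrite distrC.
(* The only error is the second-order term [K * dot h h <= K N |h|^2], which is below [eps |h|] once
   [|h|] is below [eps / (K (N + 1))]. *)
have NK : 0 < K * (N%:R + 1) by rewrite mulr_gt0// ltr_wpDl.
have near2 : \forall z' \near z, `|z - z'| < eps / (K * (N%:R + 1)).
  have := contn z z => /cvgr_lt/(_ (eps / (K * (N%:R + 1)))); apply.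
  by rewrite subrr normr0 divr_gt0.
have FF : Filter (nbhs z) by exact: nbhs_filter.
apply: filterS2 near1 near2 => z' z'rho z'eps.
have : psi z <= psi z' by apply: zmin; rewrite inE /A /= ltW.
rewrite /psi -/v.
pose h := z' - z.
have -> : z' - z0 = v + h by rewrite /v /h [RHS]addrC subrKA.
rewrite -/h dotDD dotZl => psih.
have hh : K * dot h h <= eps * `|h|.
  rewrite (le_trans (_ : _ <= K * (N%:R + 1) * `|h| * `|h|))//; last first.
    rewrite ler_wpM2r// mulrC -ler_pdivlMr// ltW//.
    by rewrite /h distrC.
  rewrite -!mulrA ler_pM2l// mulrA (le_trans (ler_norm _))//.
  rewrite (le_trans (norm_dot_le _ _))// ler_wpM2r//.
  rewrite (le_trans (_ : _ <= \sum_(j < N) `|h|))//.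
    by apply: ler_sum => j _; exact: coord_le_norm.
  by rewrite sumr_const card_ord mulrDl mul1r mulr_natl lerDl.
lra.
Unshelve. all: by end_near. Qed.

(** Points tending to [z0] carry regular subgradients bounded by [2 L]; by compactness these have a
    cluster point, which is a limiting subgradient at [z0]. *)
Lemma lipschitz_subdiff_nonempty phi z0 (L r : R) : 0 < L -> 0 < r ->
  (forall x y, `|z0 - x| < r -> `|z0 - y| < r ->
    `|phi x - phi y| <= L * `|x - y|) ->
  subdiff phi z0 !=set0.
Proof.
move=> L0 r0 phiL.
have /choice[w wP] : forall k : nat, exists w : 'rV[R]_N * 'rV[R]_N,
    [/\ `|z0 - w.1| <= k.+1%:R^-1, `|w.2| <= 2 * L & regular_subdiff phi w.1 w.2].
  move=> k; have k0 : 0 < k.+1%:R^-1 :> R by rewrite invr_gt0.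
  have [z [zeta zP]] := lipschitz_regular_subdiff_near L0 r0 k0 phiL.
  by exists (z, zeta).
pose B := [set x : 'rV[R]_N | `|x| <= 2 * L].
have cB : compact B.
  apply: bounded_closed_compact.
    exists (2 * L); split; first exact: num_real.
    by move=> M LM x /= /le_trans; apply; exact: ltW.
  apply: (@preimage_closed _ _ (fun z : 'rV[R]_N => `|z|) [set x | x <= 2 * L]).
    by move=> x _; exact: norm_continuous.
  exact: closed_le.
have [xi [_ xiP]] : B `&` cluster ((fun k => (w k).2) @ \oo) !=set0.
  by apply: cB; exists 0%N => // k _; have [] := wP k.
(* Extraction of a convergent selection: [kap] need not be increasing, as [j <= kap j] already makes
   the base points converge to [z0]. *)
have /choice[kap kapP] : forall j : nat, exists k : nat,
    (j <= k)%N /\ `|xi - (w k).2| < j.+1%:R^-1.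
  move=> j.
  have [||x [[k /= jk <-] xk]] := xiP [set (w k).2 | k in [set k | (j <= k)%N]]
      (ball xi j.+1%:R^-1).
  - by exists j => // k jk; exists k.
  - by apply: nbhsx_ballx; rewrite invr_gt0.
  - by exists k; split => //; move: xk; rewrite -ball_normE.
exists xi, (fun j => (w (kap j)).1), (fun j => (w (kap j)).2); split.
- apply/cvgrPdist_le => e e0; near=> j.
  have [+ _ _] := wP (kap j); move=> /le_trans; apply.
  rewrite (le_trans (_ : _ <= j.+1%:R^-1))//.
    by rewrite lef_pV2 ?posrE// ler_nat ltnS; have [] := kapP j.
  by apply: ltW; near: j; exact: (near_infty_natSinv_lt (PosNum e0)).
- apply/cvgrPdist_le => e e0; near=> j.
  have [_ /ltW/le_trans] := kapP j; apply.
  by apply: ltW; near: j; exact: (near_infty_natSinv_lt (PosNum e0)).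
- by move=> j; have [] := wP (kap j).
Unshelve. all: by end_near. Qed.

(** One inclusion of the smooth sum rule suffices: adding [grad psi] along the sequences that define
    [xi] yields sequences for the sum, by continuity of the gradient. *)
Lemma subdiffD phi psi z : C1 psi -> subdiff phi z !=set0 ->
  subdiff (fun x => psi x + phi x) z !=set0.
Proof.
move=> [dpsi cpsi] [xi [zk [xik [zkz xikxi reg]]]].
exists (grad psi z + xi), zk, (fun k => grad psi (zk k) + xik k); split => //.
  apply: cvgD => //; apply/cvgrPdist_le => e e0.
  have : \forall k \near \oo, forall j, `|'d psi z 'e_j - 'd psi (zk k) 'e_j| <= e.
    apply: filter_forall => j.
    have : 'd psi (zk k) 'e_j @[k --> \oo] --> 'd psi z 'e_j.
      exact: (cvg_comp zk _ zkz (cpsi 'e_j z)).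
    by move=> /cvgrPdist_le; exact.
  apply: filterS => k kP; apply: norm_le_coord; first exact: ltW.
  by move=> i j; rewrite !mxE; exact: kP.
(* Half of [e] covers the first-order remainder of [psi], the other half the subgradient inequality
   of [phi]. *)
move=> k e e0; have e20 : 0 < e / 2 by rewrite divr_gt0.
have FF : Filter (nbhs (zk k)) by exact: nbhs_filter.
have [[_ +]] := dpsi (zk k); rewrite lim_id// => /eqaddoP/(_ _ e20).
apply: filterS2 (reg k _ e20) => z' phiz.
have -> : dot (grad psi (zk k) + xik k) (z' - zk k) =
    'd psi (zk k) (z' - zk k) + dot (xik k) (z' - zk k).
  rewrite -(dot_gradE psi) /dot -big_split; apply: eq_bigr => j _.
  by rewrite [(_ + xik k) 0 j]mxE mulrDl.
by move=> /ler_normlP[]; rewrite /= !fctE => psiz _; lra.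
Qed.

End Subdifferential.

(** * RCPLD under full rank *)

Section FullRank.
Context {R : realType} {N : nat}.

Lemma dim_rV_full : \dim (fullv : {vspace 'rV[R]_N}) = N.
Proof. by rewrite dimvf /dim /= mul1n. Qed.

Lemma free_map_eq0 {I : eqType} (f : I -> 'rV[R]_N) (r : seq I) (c : I -> R) :
  free [seq f t | t <- r] -> \sum_(t <- r) c t *: f t = 0 ->
  forall t, t \in r -> c t = 0.
Proof.
move=> fr; have sr : size [seq f t | t <- r] = size r by rewrite size_map.
case: r fr sr => // t0 r0; set r := t0 :: r0 => fr sr cf t /(nthP t0)[i ir <-].
have ir' : (i < size [seq f t | t <- r])%N by rewrite sr.
have := @freeP _ _ _ (in_tuple [seq f t | t <- r]) fr (fun j => c (nth t0 r j)).
move=> /(_ _ (Ordinal ir')); apply.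
rewrite -(big_mkord xpredT (fun j => c (nth t0 r j) *: [seq f t | t <- r]`_j)).
rewrite size_map -[RHS]cf (big_nth t0) !big_mkord; apply: eq_bigr => j _.
by congr (_ *: _); rewrite (nth_map t0).
Qed.

Context {T E : finType} {m : nat}.
Variables (theta : T -> 'rV[R]_N -> R) (e : E -> 'rV[R]_N -> R).
Variables (Gc Hc : 'I_m -> 'rV[R]_N -> R) (Ith : {set T}) (I J K : {set 'I_m}).

(** A sum type merges the three kinds of constraints into one family, to which the results on
    injective joint differentials apply. *)
Definition constr (t : E + 'I_m + 'I_m) : 'rV[R]_N -> R :=
  match t with
  | inl (inl j) => e j
  | inl (inr i) => Gc i
  | inr i => Hc i
  end.

Definition constr_seq (I1 : {set E}) (A B : {set 'I_m}) : seq (E + 'I_m + 'I_m) :=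
  [seq inl (inl j) | j <- enum I1] ++
  [seq inl (inr i) | i <- enum A] ++ [seq inr i | i <- enum B].

Lemma grad_constr_seq I1 A B z :
  [seq grad (constr t) z | t <- constr_seq I1 A B] =
  [seq grad (e j) z | j <- enum I1] ++
  [seq grad (Gc i) z | i <- enum A] ++ [seq grad (Hc i) z | i <- enum B].
Proof. by rewrite !map_cat -!map_comp. Qed.

(* If the gradients of the equality family have full rank, every basis chosen
   among them has [N] elements, so any further vector makes a dependent family. *)
Lemma RCPLD_full_rank (zs : 'rV[R]_N) :
  (forall t, C1 (constr t)) ->
  injective_diff constr (constr_seq [set: E]%SET I K) zs ->
  I :&: J = finset.set0 -> K :&: J = finset.set0 ->
  RCPLD theta e Gc Hc Ith I J K zs.
Proof.
move=> C1c inj IJ KJ.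
have sp z : injective_diff constr (constr_seq [set: E]%SET I K) z ->
    <<[seq grad (e j) z | j <- enum [set: E]%SET] ++
      [seq grad (Gc i) z | i <- enum I] ++ [seq grad (Hc i) z | i <- enum K]>>%VS
    = fullv.
  by move=> ?; rewrite -grad_constr_seq; exact: span_grad_full.
split.
  have := near_injective_diff C1c inj.
  have FF : Filter (nbhs zs) by exact: nbhs_filter.
  apply: filterS => z /sp dz.
  exact: etrans (congr1 (fun U => \dim U) dz)
    (esym (congr1 (fun U => \dim U) (sp _ inj))).
move=> I1 I2 I3 sI2 sI3 bas0 I4 I5 I6 s4 s5 s6 ws lam mu a b _ _ a0 b0 nz _ eq0 zk wk _ _ _.
have bas : basis_of fullv [seq grad (constr t) zs | t <- constr_seq I1 I2 I3].
  by rewrite grad_constr_seq -(sp _ inj).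
have sz : (#|I1| + (#|I2| + #|I3|) = N)%N.
  have /andP[/eqP spbas /eqP] := bas.
  by rewrite spbas dim_rV_full size_map !size_cat !size_map -!cardE.
(* The added indices lie in [J], which is disjoint from [I] and [K], so the cardinalities add up. *)
have dis (A B C : {set 'I_m}) : A \subset B -> B :&: J = finset.set0 -> C \subset J ->
    #|A :|: C| = (#|A| + #|C|)%N.
  move=> AB BJ CJ; rewrite cardsU; suff -> : A :&: C = finset.set0 by rewrite cards0 subn0.
  by apply/eqP; rewrite -finset.subset0 -BJ finset.setISS.
(* If some index is added, the family has more than [N] vectors and is dependent at every point. *)
have [/eqP|] := eqVneq (#|I4| + #|I5| + #|I6|)%N 0%N; last first.
  rewrite -lt0n => pos; apply: nearW => k; apply/negP.
  rewrite /free => /eqP fr.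
  have : (\dim <<[seq wk i k | i <- enum I4] ++ [seq grad (constr t) (zk k) |
      t <- constr_seq I1 (I2 :|: I5) (I3 :|: I6)]>> <= N)%N.
    by rewrite -[X in (_ <= X)%N]dim_rV_full dimvS// subvf.
  rewrite -grad_constr_seq in fr.
  rewrite fr !size_cat !size_map !size_cat !size_map -!cardE !(dis _ _ _ sI2 IJ s5) (dis _ _ _ sI3 KJ s6).
  by move: pos sz; clear; lia.
rewrite !addn_eq0 !cards_eq0 => /andP[/andP[/eqP I40 /eqP I50] /eqP I60].
(* With nothing added, the assumed relation is a vanishing combination of the basis at [zs]; all
   multipliers are then 0, against the assumption that they are not. *)
move: eq0 a0 b0 nz; rewrite I40 I50 I60 !finset.setU0 big_set0 add0r => eq0 a0 b0 [].
pose c t := match t with inl (inl j) => mu j | inl (inr i) => - a i | inr i => - b i end.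
have c0 : forall t, t \in constr_seq I1 I2 I3 -> c t = 0.
  apply: (free_map_eq0 (basis_free bas)).
  rewrite !big_cat !big_map /= !big_enum /=.
  refine (etrans _ (esym eq0)).
  rewrite -[RHS]addrA.
  congr (_ + (_ + _)); rewrite -sumrN.
    by apply: eq_bigr => i _; rewrite scaleNr.
  by apply: eq_bigr => i _; rewrite scaleNr.
split.
- by move=> i; rewrite inE.
- by move=> j jI; apply: (c0 (inl (inl j))); rewrite !mem_cat map_f// mem_enum.
- move=> i iI; apply/eqP; rewrite -oppr_eq0; apply/eqP.
  by apply: (c0 (inl (inr i))); rewrite !mem_cat map_f ?orbT// mem_enum.
- move=> i iI; apply/eqP; rewrite -oppr_eq0; apply/eqP.
  by apply: (c0 (inr i)); rewrite !mem_cat map_f ?orbT// mem_enum.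
Qed.

End FullRank.

(** * Calculus of continuously differentiable functions *)

Section ScalarC1.
Context {R : realType} {N : nat}.
Implicit Types (phi psi : 'rV[R]_N -> R) (dphi dpsi : 'rV[R]_N -> 'rV[R]_N -> R).

(** Carrying an explicit differential lets the closure lemmas below prove continuous
    differentiability and compute the derivative at once. *)
Definition has_C1_diff phi dphi : Prop :=
  (forall p, is_diff p phi (dphi p)) /\ (forall v, continuous (dphi ^~ v)).

Lemma has_C1_diff_C1 phi dphi : has_C1_diff phi dphi -> C1 phi.
Proof.
move=> [dphiP cphi]; split=> [p|v]; first by have [] := dphiP p.
suff -> : (fun p => 'd phi p v) = dphi ^~ v by exact: cphi.
by apply/funext => p; have [_ ->] := dphiP p.
Qed.

Lemma has_C1_diffE phi dphi p v : has_C1_diff phi dphi -> 'd phi p v = dphi p v.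
Proof. by move=> [dphiP _]; have [_ ->] := dphiP p. Qed.

Lemma has_C1_diff_ext phi psi dphi dpsi : phi =1 psi ->
  (forall p v, dphi p v = dpsi p v) -> has_C1_diff phi dphi -> has_C1_diff psi dpsi.
Proof.
move=> /funext -> dE; suff -> : dphi = dpsi by [].
by apply/funext => p; apply/funext => v.
Qed.

Lemma has_C1_diffD phi psi dphi dpsi :
  has_C1_diff phi dphi -> has_C1_diff psi dpsi ->
  has_C1_diff (fun p => phi p + psi p) (fun p v => dphi p v + dpsi p v).
Proof.
move=> [p1 p2] [q1 q2]; split=> [p|v p]; first exact: is_diffD.
by apply: (@cvgD _ _ _ (nbhs p)); [exact: p2|exact: q2].
Qed.

Lemma has_C1_diffN phi dphi :
  has_C1_diff phi dphi -> has_C1_diff (fun p => - phi p) (fun p v => - dphi p v).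
Proof.
move=> [p1 p2]; split=> [p|v p]; first exact: is_diffN.
by apply: (@cvgN _ _ _ (nbhs p)); exact: p2.
Qed.

Lemma has_C1_diffM phi psi dphi dpsi :
  has_C1_diff phi dphi -> has_C1_diff psi dpsi ->
  has_C1_diff (fun p => phi p * psi p)
    (fun p v => phi p * dpsi p v + psi p * dphi p v).
Proof.
move=> [p1 p2] [q1 q2]; split=> [p|v p]; first exact: is_diffM.
have [dp _] := p1 p; have [dq _] := q1 p.
apply: (@cvgD _ _ _ (nbhs p)); apply: (@cvgM _ _ (nbhs p)) => //.
- exact: differentiable_continuous dp.
- exact: q2.
- exact: differentiable_continuous dq.
- exact: p2.
Qed.

Lemma has_C1_diff_cst c : has_C1_diff (fun=> c) (fun _ _ => 0).
Proof. by split=> [p|v]; [exact: is_diff_cst|exact: cst_continuous]. Qed.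

Lemma has_C1_diff_sum k (F : 'I_k -> 'rV[R]_N -> R) (DF : 'I_k -> 'rV[R]_N -> 'rV[R]_N -> R) :
  (forall i, has_C1_diff (F i) (DF i)) ->
  has_C1_diff (fun p => \sum_i F i p) (fun p v => \sum_i DF i p v).
Proof.
move=> F_C1; elim: (index_enum _) => [|i s IH].
  have -> : (fun p => \sum_(i <- [::]) F i p) = (fun=> 0).
    by apply/funext => p; rewrite big_nil.
  have -> : (fun p v => \sum_(i <- [::]) DF i p v) = (fun _ _ => 0).
    by apply/funext => p; apply/funext => v; rewrite big_nil.
  exact: has_C1_diff_cst.
have -> : (fun p => \sum_(i <- i :: s) F i p) =
    (fun p => F i p + \sum_(i <- s) F i p).
  by apply/funext => p; rewrite big_cons.
have -> : (fun p v => \sum_(i <- i :: s) DF i p v) =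
    (fun p v => DF i p v + \sum_(i <- s) DF i p v).
  by apply/funext => p; apply/funext => v; rewrite big_cons.
exact: has_C1_diffD.
Qed.

Lemma differentiable_coords k (Phi : 'rV[R]_N -> 'rV[R]_k) p :
  (forall j, differentiable (fun x => Phi x 0 j) p) -> differentiable Phi p.
Proof.
move=> dPhi.
have -> : Phi = \sum_j (fun x => Phi x 0 j *: 'e_j).
  by apply/funext => x; rewrite fct_sumE -row_sum_delta.
by apply: differentiable_sum => j; exact: differentiableZl.
Qed.

Lemma is_diff_coord a b (Phi : 'rV[R]_N -> 'M[R]_(a, b)) p i j :
  differentiable Phi p ->
  is_diff p (fun x => Phi x i j) (fun v => 'd Phi p v i j).
Proof.
move=> dPhi.
pose c : 'M[R]_(a, b) -> R := fun A => A i j.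
have linc : linear c by move=> k A B; rewrite /c !mxE.
(* Reading off an entry is linear and continuous, hence its own differential, and the chain rule
   applies. *)
pose cL : {linear 'M[R]_(a, b) -> R} :=
  HB.pack c (GRing.isLinear.Build _ _ _ _ _ linc).
have cc : continuous cL by exact: coord_continuous.
have dc : is_diff (Phi p) cL cL.
  by split; [exact: linear_differentiable|exact: diff_lin].
have dp : is_diff p Phi ('d Phi p) by exact: differentiableP.
exact: (is_diff_comp dp dc).
Qed.

Lemma has_C1_diff_coord a b (Phi : 'rV[R]_N -> 'M[R]_(a, b)) i j : C1 Phi ->
  has_C1_diff (fun x => Phi x i j) (fun p v => 'd Phi p v i j).
Proof.
move=> [dPhi cPhi]; split=> [p|v p]; first exact: is_diff_coord.
exact: (cvg_comp (fun q => 'd Phi q v) (fun A : 'M[R]_(a, b) => A i j)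
  (cPhi v p) (@coord_continuous _ _ _ i j _)).
Qed.

End ScalarC1.

Lemma has_C1_diff_comp (R : realType) (N N' : nat) (phi : 'rV[R]_N -> R) dphi
    (L : {linear 'rV[R]_N' -> 'rV[R]_N}) : continuous L ->
  has_C1_diff phi dphi ->
  has_C1_diff (fun p => phi (L p)) (fun p v => dphi (L p) (L v)).
Proof.
move=> cL [p1 p2]; split=> [p|v p].
  have dL : is_diff p L L by split; [exact: linear_differentiable|exact: diff_lin].
  exact: (is_diff_comp dL (p1 (L p))).
exact: (cvg_comp _ _ (cL p) (p2 (L v) (L p))).
Qed.

Lemma has_C1_diff_lin_coord (R : realType) (N N' : nat)
    (L : {linear 'rV[R]_N' -> 'rV[R]_N}) j : continuous L ->
  has_C1_diff (fun p => L p 0 j) (fun _ v => L v 0 j).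
Proof.
move=> cL.
have dL p : 'd L p = L :> (_ -> _) by exact: diff_lin.
have -> : (fun _ v => L v 0 j) = (fun p v => 'd L p v 0 j).
  by apply/funext => p; rewrite dL.
apply: has_C1_diff_coord; split; first by move=> p; exact: linear_differentiable.
move=> v; have -> : (fun p => 'd L p v) = (fun=> L v) by apply/funext => p; rewrite dL.
exact: cst_continuous.
Qed.

Lemma jacE (R : realType) N k (phi : 'rV[R]_N -> 'rV[R]_k) p v :
  v *m (jac phi p)^T = 'd phi p v.
Proof. by rewrite /jac trmxK /jacobian mul_rV_lin1. Qed.

Lemma row_jac (R : realType) N k (phi : 'rV[R]_N -> 'rV[R]_k) p i :
  differentiable phi p -> row i (jac phi p) = grad (component phi i) p.
Proof.
move=> dphi; apply/rowP => j; rewrite !mxE.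
by have [_ ->] := is_diff_coord 0 i dphi.
Qed.

(** * Differentials of the constraints *)

Lemma row_combination_coord (R : realType) (s m n : nat) (x : 'rV[R]_s) (u : 'rV_m)
    (A : 'M[R]_(m, s)) (v : 'rV_n) (B : 'M[R]_(n, s)) j :
  (x + u *m A + v *m B) 0 j
    = x 0 j + \sum_i u 0 i * A i j + \sum_i v 0 i * B i j.
Proof. by rewrite 2!mxE; congr (_ + _ + _); rewrite mxE. Qed.

(** This separates the product-rule terms of [grad_yL] into those with the multipliers frozen and
    those with the point [(x, y)] frozen. *)
Lemma sum_product_rule (R : realType) (m n : nat) (x : R) (u du a da : 'I_m -> R)
    (v dv b db : 'I_n -> R) :
  x + \sum_i (u i * da i + a i * du i) + \sum_i (v i * db i + b i * dv i)
  = x + \sum_i u i * da i + \sum_i v i * db i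
    + \sum_i du i * a i + \sum_i dv i * b i.
Proof.
rewrite !big_split /=.
have -> : \sum_i a i * du i = \sum_i du i * a i.
  by apply: eq_bigr => i _; rewrite mulrC.
have -> : \sum_i b i * dv i = \sum_i dv i * b i.
  by apply: eq_bigr => i _; rewrite mulrC.
ring.
Qed.

Section CombinedProgramConstraints.
Context {R : realType} {d s m n p q : nat}.
Variable P : combined_program R d s m n p q.
Local Notation G := (upG P).
Local Notation H := (upH P).
Local Notation f := (lowf P).
Local Notation g := (lowg P).
Local Notation h := (lowh P).
Local Notation Z := 'rV[R]_(d + s + (m + n)).
Hypotheses (H_C1 : C1 H) (g_C1 : C1 g) (h_C1 : C1 h).
Hypotheses (fy_C1 : C1 (grad_y f)) (gy_C1 : C1 (jac_y g)) (hy_C1 : C1 (jac_y h)).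

Local Notation gL z := (fun w => grad_yL P w (zu z) (zv z)).

Definition CP_constr := constr (CP_eq P) (fun i z => - g (zxy z) 0 i)
  (fun (i : 'I_m) (z : Z) => zu z 0 i).

(** The differential of each constraint at [z] in direction [v]. The [grad_yL] case is written to
    match the first block row of [Jstar]: derivative in [(x, y)] with multipliers frozen, then the
    terms linear in the multiplier increments. *)
Definition CP_constr_diff (t : 'I_q + 'I_n + 'I_s + 'I_m + 'I_m) (z v : Z) : R :=
  match t with
  | inl (inl (inl (inl j))) => 'd H (zxy z) (zxy v) 0 j
  | inl (inl (inl (inr j))) => 'd h (zxy z) (zxy v) 0 j
  | inl (inl (inr j)) => ('d (gL z) (zxy z) (zxy v)
      + zu v *m jac_y g (zxy z) + zv v *m jac_y h (zxy z)) 0 j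
  | inl (inr i) => - 'd g (zxy z) (zxy v) 0 i
  | inr i => zu v 0 i
  end.

Lemma grad_yL_coord w u v j : grad_yL P w u v 0 j =
  grad_y f w 0 j + \sum_i u 0 i * jac_y g w i j + \sum_i v 0 i * jac_y h w i j.
Proof. exact: row_combination_coord. Qed.

Lemma has_C1_diff_grad_yL u v j :
  has_C1_diff (fun w => grad_yL P w u v 0 j)
    (fun w dw => 'd (grad_y f) w dw 0 j
      + \sum_i u 0 i * 'd (jac_y g) w dw i j + \sum_i v 0 i * 'd (jac_y h) w dw i j).
Proof.
apply: has_C1_diff_ext (fun w => esym (grad_yL_coord w u v j)) _ _; last first.
  apply: has_C1_diffD; first apply: has_C1_diffD.
  - exact: has_C1_diff_coord fy_C1.
  - apply: has_C1_diff_sum => i.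
    by apply: has_C1_diffM; [exact: has_C1_diff_cst|exact: has_C1_diff_coord gy_C1].
  - apply: has_C1_diff_sum => i.
    by apply: has_C1_diffM; [exact: has_C1_diff_cst|exact: has_C1_diff_coord hy_C1].
move=> w dw; congr (_ + _ + _); apply: eq_bigr => i _; by rewrite mulr0 addr0.
Qed.

Lemma diff_grad_yL u v w dw j :
  'd (fun w' => grad_yL P w' u v) w dw 0 j = 'd (grad_y f) w dw 0 j
    + \sum_i u 0 i * 'd (jac_y g) w dw i j + \sum_i v 0 i * 'd (jac_y h) w dw i j.
Proof.
(* The vector-valued map must be differentiable before a coordinate of its differential can be
   identified with the differential of that coordinate. *)
have df : differentiable (fun w' => grad_yL P w' u v) w.
  by apply: differentiable_coords => l; have [/(_ w)[]] := has_C1_diff_grad_yL u v l.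
have [_ /(congr1 (@^~ dw)) dE] := is_diff_coord 0 j df.
exact: etrans (esym dE) (has_C1_diffE _ _ (has_C1_diff_grad_yL u v j)).
Qed.

Lemma CP_constr_C1_diff t : has_C1_diff (CP_constr t) (CP_constr_diff t).
Proof.
pose Lxy : {linear Z -> 'rV[R]_(d + s)} := lsubmx.
pose Lu : {linear Z -> 'rV[R]_m} := lsubmx \o rsubmx.
pose Lv : {linear Z -> 'rV[R]_n} := rsubmx \o rsubmx.
have cxy : continuous Lxy by exact: continuous_lsubmx.
have cu : continuous Lu.
  by move=> z; apply: continuous_comp; [exact: continuous_rsubmx|exact: continuous_lsubmx].
have cv : continuous Lv.
  by move=> z; apply: continuous_comp; exact: continuous_rsubmx.
case: t => [[[[j|j]|j]|i]|i].
- exact: (has_C1_diff_comp cxy (has_C1_diff_coord 0 j H_C1)).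
- exact: (has_C1_diff_comp cxy (has_C1_diff_coord 0 j h_C1)).
- apply: has_C1_diff_ext (fun z => esym (grad_yL_coord (zxy z) (zu z) (zv z) j)) _ _;
    last first.
    apply: has_C1_diffD; first apply: has_C1_diffD.
    + exact: (has_C1_diff_comp cxy (has_C1_diff_coord 0 j fy_C1)).
    + apply: has_C1_diff_sum => i; apply: has_C1_diffM.
        exact: (has_C1_diff_lin_coord i cu).
      exact: (has_C1_diff_comp cxy (has_C1_diff_coord i j gy_C1)).
    + apply: has_C1_diff_sum => i; apply: has_C1_diffM.
        exact: (has_C1_diff_lin_coord i cv).
      exact: (has_C1_diff_comp cxy (has_C1_diff_coord i j hy_C1)).
  move=> z v; apply: etrans (sum_product_rule _ _ _ _ _ _ _ _ _) (esym _).
  apply: etrans (row_combination_coord _ _ _ _ _ _) _.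
  by congr (_ + _ + _); exact: diff_grad_yL.
- exact: (has_C1_diffN (has_C1_diff_comp cxy (has_C1_diff_coord 0 i g_C1))).
- exact: (has_C1_diff_lin_coord i cu).
Qed.

End CombinedProgramConstraints.

(** * Consequences of the rank condition *)

Section BlockMatrix.
Context {R : realType} {D s n q a b : nat}.
Variables (JL : 'M[R]_(s, D)) (hy : 'M[R]_(n, s)) (gy : 'M[R]_(a, s)).
Variables (jh : 'M[R]_(n, D)) (jH : 'M[R]_(q, D)) (jg : 'M[R]_(b, D)).

Local Notation J :=
  (block_mx JL (row_mx hy^T gy^T) (col_mx jh (col_mx jH jg)) 0).

(** The four equations say, in transposed form, that [J] kills the column made of [x], [v], [u];
    full column rank makes this column 0. *)
Lemma block_full_rank_kernel x v u : \rank J = (D + (n + a))%N ->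
  x *m JL^T + v *m hy + u *m gy = 0 ->
  x *m jh^T = 0 -> x *m jH^T = 0 -> x *m jg^T = 0 ->
  [/\ x = 0, v = 0 & u = 0 :> 'rV[R]_a].
Proof.
move=> rJ e1 e2 e3 e4.
have fJ : row_free J^T by rewrite /row_free mxrank_tr rJ.
have : row_mx x (row_mx v u) *m J^T = 0.
  rewrite tr_block_mx mul_row_block trmx0 mulmx0 addr0.
  rewrite tr_row_mx !trmxK mul_row_col addrA e1 !tr_col_mx !mul_mx_row e2 e3 e4.
  by rewrite !row_mx0.
move=> xJ; have : row_mx x (row_mx v u) = 0.
  by apply: (row_free_inj fJ); rewrite xJ mul0mx.
rewrite -[0]row_mx0 => /eq_row_mx[-> ]; rewrite -[0]row_mx0 => /eq_row_mx[-> ->].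
by [].
Qed.

(** Full column rank gives a left inverse [B] of [J], so [row_mx c 0 *m B] solves
    [l *m J = row_mx c 0]; its blocks are the four multipliers. *)
Lemma block_full_rank_solve (c : 'rV[R]_D) : \rank J = (D + (n + a))%N ->
  exists lamL lamh lamH lamg,
    [/\ c = lamL *m JL + lamh *m jh + lamH *m jH + lamg *m jg,
        lamL *m hy^T = 0 & lamL *m gy^T = 0].
Proof.
move=> rJ; have /row_fullP[B BJ] : row_full J by rewrite /row_full rJ.
pose l := row_mx c (0 : 'rV[R]_(n + a)) *m B.
have lJ : l *m J = row_mx c 0 by rewrite /l -mulmxA BJ mulmx1.
exists (lsubmx l), (lsubmx (rsubmx l)), (lsubmx (rsubmx (rsubmx l))),
  (rsubmx (rsubmx (rsubmx l))).
move: lJ; rewrite -[in X in X -> _](hsubmxK l) mul_row_block mulmx0 addr0.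
rewrite -[in X in X -> _](hsubmxK (rsubmx l)) mul_row_col.
rewrite -[in X in X -> _](hsubmxK (rsubmx (rsubmx l))) mul_row_col mul_mx_row.
by rewrite -[0]row_mx0 !addrA => /eq_row_mx[-> /eq_row_mx[-> ->]].
Qed.

End BlockMatrix.

Lemma mul_rowsub_enum (R : realType) (m k : nat) (A : {set 'I_m}) (u : 'rV[R]_m)
    (M : 'M[R]_(m, k)) : (forall i, i \notin A -> u 0 i = 0) ->
  (\row_(j < #|A|) u 0 (enum_val j)) *m rowsub (fun j : 'I_#|A| => enum_val j) M
  = u *m M.
Proof.
move=> uA; apply/rowP => j; rewrite !mxE.
rewrite [RHS](bigID (mem A)) /= [X in _ = _ + X]big1 ?addr0; last first.
  by move=> i iA; rewrite uA// mul0r.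
rewrite [RHS]big_enum_val; apply: eq_bigr => l _; by rewrite !mxE.
Qed.

(** * Index sets and injectivity of the differential at a feasible point *)

Section CombinedProgramRank.
Context {R : realType} {d s m n p q : nat}.
Variable P : combined_program R d s m n p q.
Local Notation G := (upG P).
Local Notation H := (upH P).
Local Notation f := (lowf P).
Local Notation g := (lowg P).
Local Notation h := (lowh P).
Local Notation Z := 'rV[R]_(d + s + (m + n)).
Variable z : Z.

(** A sum of nonnegative products vanishes only if each product does, so orthogonality in [Omega]
    holds componentwise. *)
Lemma feasible_complementarity : CP_feasible P z -> forall i,
  [/\ g (zxy z) 0 i <= 0, 0 <= zu z 0 i & g (zxy z) 0 i = 0 \/ zu z 0 i = 0].
Proof.
move=> [_ _ _ _ []]; rewrite row_mxKl row_mxKr => g0 u0 gu i.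
have gi k : g (zxy z) 0 k <= 0 by have := g0 k; rewrite mxE oppr_ge0.
split => //.
have /eqP : dot (- g (zxy z)) (zu z) = 0 by [].
rewrite psumr_eq0; last by move=> k _; rewrite mulr_ge0.
move=> /allP/(_ i (mem_index_enum _)) /=.
by rewrite mxE mulNr oppr_eq0 mulf_eq0 => /orP[]/eqP; [left|right].
Qed.

Lemma set_IJ_K : CP_feasible P z -> set_I P z :|: set_J P z = (~: set_K P z)%SET.
Proof.
move=> /feasible_complementarity fz; apply/setP => i; rewrite !inE.
have [g0 u0 gu] := fz i; case: (eqVneq (g (zxy z) 0 i) 0) => [->|gn0].
  by rewrite ltxx /= lt_neqAle [0 == _]eq_sym u0 andbT orNb.
have -> : zu z 0 i = 0 by case: gu => // gi; rewrite gi eqxx in gn0.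
have -> : g (zxy z) 0 i < 0 by rewrite lt_neqAle gn0 g0.
by rewrite eqxx.
Qed.

Hypothesis z_feasible : CP_feasible P z.
Hypothesis rank_J : \rank (Jstar P z) = (d + s + m + n - #|set_K P z|)%N.

Lemma rank_Jstar_full :
  \rank (Jstar P z) = ((d + s) + (n + #|set_I P z :|: set_J P z|))%N.
Proof.
rewrite rank_J set_IJ_K// (cardsCs (~: set_K P z)%SET) finset.setCK card_ord.
(* This bound is what makes the truncated subtraction in the rank an honest one. *)
have : (#|set_K P z| <= m)%N by rewrite -[X in (_ <= X)%N]card_ord max_card.
clear; lia.
Qed.

Hypotheses (H_C1 : C1 H) (g_C1 : C1 g) (h_C1 : C1 h).
Hypotheses (fy_C1 : C1 (grad_y f)) (gy_C1 : C1 (jac_y g)) (hy_C1 : C1 (jac_y h)).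

(** For a direction killed by these differentials, the [u] part vanishes on [K], so it is determined
    by its restriction to the union of [I] and [J]. The [(x, y)] part, the [v] part and this
    restriction form a kernel vector of [Jstar]. *)
Lemma Jstar_injective_diff :
  injective_diff (CP_constr P)
    (constr_seq [set: 'I_q + 'I_n + 'I_s]%SET (set_I P z) (set_K P z)) z.
Proof.
move=> v v0.
have dv t : t \in constr_seq [set: 'I_q + 'I_n + 'I_s]%SET (set_I P z) (set_K P z) ->
    CP_constr_diff P t z v = 0.
  move=> /v0; apply: etrans; apply: esym; apply: has_C1_diffE.
  exact: CP_constr_C1_diff.
have dE j : CP_constr_diff P (inl (inl j)) z v = 0.
  by apply: dv; rewrite !mem_cat map_f// mem_enum inE.
have dI i : i \in set_I P z -> CP_constr_diff P (inl (inr i)) z v = 0.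
  by move=> iI; apply: dv; rewrite !mem_cat map_f ?orbT// mem_enum.
have uK i : i \in set_K P z -> zu v 0 i = 0.
  by move=> iK; apply: (dv (inr i)); rewrite !mem_cat map_f ?orbT// mem_enum.
have uA i : i \notin set_I P z :|: set_J P z -> zu v 0 i = 0.
  by rewrite set_IJ_K// finset.in_setC negbK => /uK.
pose A := set_I P z :|: set_J P z.
have := block_full_rank_kernel (x := zxy v) (v := zv v)
  (u := \row_(j < #|A|) zu v 0 (enum_val j)) rank_Jstar_full.
have gyA : rsubmx (jac_sub g A (zxy z)) = rowsub (fun j : 'I_#|A| => enum_val j)
    (jac_y g (zxy z)).
  by apply/matrixP => i j; rewrite !mxE.
rewrite [rsubmx _]gyA (mul_rowsub_enum _ uA).
case.
- rewrite jacE -addrA [X in _ + X]addrC addrA.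
  by apply/rowP => j; rewrite [RHS]mxE; exact: (dE (inr j)).
- by rewrite jacE; apply/rowP => j; rewrite [RHS]mxE; exact: (dE (inl (inr j))).
- by rewrite jacE; apply/rowP => j; rewrite [RHS]mxE; exact: (dE (inl (inl j))).
- apply/rowP => k; rewrite [RHS]mxE.
  have := dI _ (enum_valP k) => /eqP; rewrite oppr_eq0 => /eqP.
  apply: etrans; rewrite -(jacE g) mxE [RHS]mxE; apply: eq_bigr => j _.
  by rewrite !mxE.
move=> x0 vv0 /rowP u0; rewrite -[v]hsubmxK -[rsubmx v]hsubmxK.
have -> : lsubmx (rsubmx v) = 0.
  apply/rowP => i; rewrite [RHS]mxE; have [iA|/uA//] := boolP (i \in A).
  by have := u0 (enum_rank_in iA i); rewrite !mxE enum_rankK_in.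
by rewrite -/(zxy v) -/(zv v) x0 vv0 !row_mx0.
Qed.

End CombinedProgramRank.

(** * M-stationarity and RCPLD *)

Lemma norm_lsubmx_le (R : realType) a b (v : 'rV[R]_(a + b)) : `|lsubmx v| <= `|v|.
Proof. by apply: norm_le_coord => // i j; rewrite mxE coord_le_norm. Qed.

(** [c] is the extension of [l] by 0 outside [A]. It turns the multiplier of [g] on [I] into the
    vector [a] of M-stationarity, whose sum also ranges over [J]. *)
Lemma sum_row_rowsub (R : realType) (m k : nat) (A B : {set 'I_m})
    (l : 'rV[R]_#|A|) (M : 'M[R]_(m, k)) :
  let c := l *m rowsub (fun i : 'I_#|A| => enum_val i) 1%:M in
  (forall i, i \notin A -> c 0 i = 0) /\
  (A \subset B ->
    \sum_(i in B) c 0 i *: row i M = l *m rowsub (fun i : 'I_#|A| => enum_val i) M).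
Proof.
move=> c; have c0 i : i \notin A -> c 0 i = 0.
  move=> iA; rewrite mxE big1// => j _; rewrite !mxE; case: eqP => [ji|]; last first.
    by rewrite mulr0.
  by move: iA; rewrite -ji enum_valP.
split=> // AB; have -> : l *m rowsub (fun i : 'I_#|A| => enum_val i) M = c *m M.
  by rewrite -mulmxA mul_rowsub_mx mul1mx.
rewrite mulmx_sum_row [RHS](bigID (mem B)) /= [X in _ = _ + X]big1 ?addr0//.
by move=> i iB; rewrite c0 ?scale0r//; apply: contra iB => /(fintype.subsetP AB).
Qed.

Lemma mul_rowsub_tr_coord (R : realType) (m k d s : nat) (e : 'I_k -> 'I_m)
    (l : 'rV[R]_s) (M : 'M[R]_(m, d + s)) j :
  (l *m (rsubmx (rowsub e M))^T) 0 j = (l *m (rsubmx M)^T) 0 (e j).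
Proof. by rewrite !mxE; apply: eq_bigr => i _; rewrite !mxE. Qed.

(** * The distance to the complementarity set *)

Section DistanceOmega.
Context {R : realType}.
Variable nu : 'rV[R]_(1 + 1) -> R.
Hypothesis nu_norm : is_norm nu.

Lemma Omega1P (w : 'rV[R]_(1 + 1)) : Omega 1 w ->
  lsubmx w 0 0 = 0 \/ rsubmx w 0 0 = 0.
Proof.
move=> [_ _]; rewrite /dot big_ord1 => /eqP; rewrite mulf_eq0.
by move=> /orP[]/eqP; [left|right].
Qed.

Lemma Omega1_0 : Omega 1 (0 : 'rV[R]_(1 + 1)).
Proof. by split=> [i|i|]; rewrite ?mxE// /dot big_ord1 !mxE mul0r. Qed.

Lemma dist_Omega_ge0 w : 0 <= dist nu (Omega 1) w.
Proof.
apply: lb_le_inf; first by exists (nu (w - 0)); exists 0 => //; exact: Omega1_0.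
by move=> _ [w' _ <-]; exact: is_norm_ge0.
Qed.

Lemma dist_Omega_eq0 w : Omega 1 w -> dist nu (Omega 1) w = 0.
Proof.
move=> ww; apply/eqP; rewrite eq_le dist_Omega_ge0 andbT.
apply: ge_inf; first by exists 0 => _ [w' _ <-]; exact: is_norm_ge0.
by exists w => //; rewrite subrr is_norm0.
Qed.

(** A point of [Omega 1] has a zero coordinate, and there its difference with the pair is exactly
    [a] or [b]. *)
Lemma dist_Omega_ge (c a b : R) : (forall x, c * `|x| <= nu x) -> 0 < c ->
  c * Num.min `|a| `|b| <= dist nu (Omega 1) (row_mx a%:M b%:M).
Proof.
move=> cP c0.
apply: lb_le_inf; first by exists (nu (row_mx a%:M b%:M - 0)); exists 0 => //; exact: Omega1_0.
move=> _ [w' /Omega1P w'0 <-]; rewrite (le_trans _ (cP _))// ler_pM2l//.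
have sub00 (k : R) (M : 'M[R]_1) : M 0 0 = 0 -> (k%:M - M) 0 0 = k.
  by move=> M0; rewrite !mxE M0 subr0 mulr1n.
rewrite -[w']hsubmxK opp_row_mx add_row_mx; case: w'0 => w0.
- have := coord_le_norm (row_mx (a%:M - lsubmx w') (b%:M - rsubmx w')) 0 (lshift 1 0).
  rewrite row_mxEl sub00//.
  by apply: le_trans; rewrite ge_min lexx.
- have := coord_le_norm (row_mx (a%:M - lsubmx w') (b%:M - rsubmx w')) 0 (rshift 1 0).
  rewrite row_mxEr sub00//.
  by apply: le_trans; rewrite ge_min lexx orbT.
Qed.

End DistanceOmega.

(** * Stationarity and RCPLD from the rank condition *)

Section MainResults.
Context {R : realType} {d s m n p q : nat}.
Variable P : combined_program R d s m n p q.
Local Notation F := (upF P).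
Local Notation G := (upG P).
Local Notation H := (upH P).
Local Notation f := (lowf P).
Local Notation g := (lowg P).
Local Notation h := (lowh P).
Local Notation Z := 'rV[R]_(d + s + (m + n)).
Variable z : Z.
Hypothesis z_feasible : CP_feasible P z.
Hypothesis rank_J : \rank (Jstar P z) = (d + s + m + n - #|set_K P z|)%N.
Hypothesis F_lip : lipschitz_around F (zxy z).
Hypothesis V_lip : value_lipschitz_around P (lsubmx (zxy z)).
Hypotheses (f_C1 : C1 f) (H_C1 : C1 H) (g_C1 : C1 g) (h_C1 : C1 h).
Hypotheses (fy_C1 : C1 (grad_y f)) (gy_C1 : C1 (jac_y g)) (hy_C1 : C1 (jac_y h)).

(** M-stationarity asks for an element of this subdifferential whatever the value of [lamV]. It
    comes from the smooth sum rule, [- V] being Lipschitz near the point as a function of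
    [(x, y)]. *)
Lemma gap_subdiff_nonempty : subdiff (gap P) (zxy z) !=set0.
Proof.
have [_ /lipschitz_aroundP[L [r [L0 r0 VL]]]] := V_lip.
apply: (subdiffD (phi := fun w => - fine (value P (lsubmx w))) f_C1).
apply: (lipschitz_subdiff_nonempty L0 r0) => x y xr yr.
have sub_lt (x' y' : 'rV[R]_(d + s)) : `|lsubmx x' - lsubmx y'| <= `|x' - y'|.
  by rewrite -raddfB norm_lsubmx_le.
rewrite -opprD normrN (le_trans (VL _ _ _ _))//.
- exact: le_lt_trans (sub_lt _ _) xr.
- exact: le_lt_trans (sub_lt _ _) yr.
- by rewrite ler_pM2l.
Qed.

Lemma CP_M_stationary : M_stationary P z.
Proof.
split => //.
have [xi xiP] : subdiff F (zxy z) !=set0.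
  have [L [r [L0 r0 FL]]] := lipschitz_aroundP F_lip.
  exact: lipschitz_subdiff_nonempty L0 r0 FL.
have [eta etaP] := gap_subdiff_nonempty.
have [lamL [lamh [lamH [lamg [xiE hyL gyL]]]]] :=
  block_full_rank_solve (- xi) (rank_Jstar_full z_feasible rank_J).
have [a0 aE] := sum_row_rowsub (set_I P z :|: set_J P z) lamg (jac g (zxy z)).
set a := _ *m _ in a0 aE.
(* The last block column of [Jstar] makes [b] vanish on both [I] and [J], which settles the sign
   alternative on [J] through [a_i b_i = 0]. *)
have b0 i : i \in set_I P z :|: set_J P z -> (lamL *m (jac_y g (zxy z))^T) 0 i = 0.
  move=> iA; rewrite -(enum_rankK_in iA iA) -[LHS]mul_rowsub_tr_coord.
  by move: gyL => /rowP/(_ (enum_rank_in iA i)); rewrite [RHS]mxE.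
exists 0, (fun=> 0), lamH, lamh, lamL, a, (lamL *m (jac_y g (zxy z))^T); split.
- by [].
- exists xi, eta; split => //.
  rewrite scale0r addr0 big1 ?addr0; last by move=> i _; rewrite scale0r.
  have -> : \sum_(i in set_I P z :|: set_J P z) a 0 i *: grad (component g i) (zxy z)
      = lamg *m jac_sub g (set_I P z) (zxy z).
    refine (etrans _ (aE (finset.subsetUl _ _))); apply: eq_bigr => i _.
    by rewrite row_jac//; exact: g_C1.1.
  rewrite -[LHS](subrr xi) xiE -!addrA; congr (_ + _).
  by rewrite addrCA [RHS]addrCA; congr (_ + _); rewrite addrCA.
- by rewrite subrr.
- split=> i iI; first by apply: b0; rewrite inE iI.
  apply: a0; move: iI; rewrite !inE => /andP[+ _].
  by apply: contraL => /andP[/eqP -> _]; rewrite ltxx.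
- by move=> i iJ; right; rewrite b0 ?mulr0// inE iJ orbT.
Qed.

Lemma CP_RCPLD_of_rank : CP_RCPLD P z.
Proof.
apply: RCPLD_full_rank.
- by move=> t; apply: has_C1_diff_C1 (CP_constr_C1_diff _ _ _ _ _ _ t).
- exact: Jstar_injective_diff.
- apply/setP => i; rewrite !inE; case: (eqVneq (zu z 0 i) 0) => [->|_].
    by rewrite ltxx !andbF.
  by rewrite !andbF.
- apply/setP => i; rewrite !inE; case: (eqVneq (g (zxy z) 0 i) 0) => [->|_].
    by rewrite ltxx.
  by rewrite andbF.
Qed.

End MainResults.

(** * Exact penalization *)

Section ExactPenalty.
Context {R : realType} {d s m n p q : nat}.
Variable P : combined_program R d s m n p q.
Local Notation F := (upF P).
Local Notation G := (upG P).
Local Notation H := (upH P).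
Local Notation f := (lowf P).
Local Notation g := (lowg P).
Local Notation h := (lowh P).
Local Notation Z := 'rV[R]_(d + s + (m + n)).
Variable nu : forall k, 'rV[R]_k -> R.
Hypothesis nu_norm : forall k, is_norm (nu (k := k)).
Local Notation phi := (phi_CP P nu).

Lemma max0_gap_ge0 (z : Z) : 0 <= Num.max 0 (gap P (zxy z)).
Proof. by rewrite le_max lexx. Qed.

Lemma sum_dist_ge0 (z : Z) :
  0 <= \sum_(i < m) dist (nu (k := (1 + 1)%N)) (Omega 1)
         (row_mx (- g (zxy z) 0 i)%:M (zu z 0 i)%:M).
Proof. by apply: sumr_ge0 => i _; exact: dist_Omega_ge0. Qed.

Lemma phi_CP_ge0 z : 0 <= phi z.
Proof. by rewrite !addr_ge0 ?max0_gap_ge0 ?sum_dist_ge0 ?is_norm_ge0. Qed.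

Lemma phi_CP_ge z :
  [/\ nu (H (zxy z)) <= phi z, nu (h (zxy z)) <= phi z,
      nu (grad_yL P (zxy z) (zu z) (zv z)) <= phi z &
      forall i, dist (nu (k := (1 + 1)%N)) (Omega 1)
         (row_mx (- g (zxy z) 0 i)%:M (zu z 0 i)%:M) <= phi z].
Proof.
have := max0_gap_ge0 z; have := sum_dist_ge0 z.
have := is_norm_ge0 (H (zxy z)) (nu_norm q).
have := is_norm_ge0 (h (zxy z)) (nu_norm n).
have := is_norm_ge0 (grad_yL P (zxy z) (zu z) (zv z)) (nu_norm s).
have := is_norm_ge0 (map_mx (Num.max 0) (G (zxy z))) (nu_norm p).
rewrite /phi_CP /= => a1 a2 a3 a4 a5 a6; split; [lra|lra|lra|move=> i].
apply: (@le_trans _ _ (\sum_(i < m) dist (nu (k := (1 + 1)%N)) (Omega 1)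
         (row_mx (- g (zxy z) 0 i)%:M (zu z 0 i)%:M))); last lra.
by rewrite (bigD1 i) //= lerDl; apply: sumr_ge0 => j _; exact: dist_Omega_ge0.
Qed.

Variable z0 : Z.
Hypothesis z0_feasible : CP_feasible P z0.

(** Finiteness of the value turns the extended-real constraint [f - V <= 0] into [gap <= 0]; every
    other term vanishes by feasibility. *)
Lemma phi_CP_eq0 : value P (lsubmx (zxy z0)) \is a fin_num -> phi z0 = 0.
Proof.
move=> Vfin; have [fV [Gle H0] h0 L0 _] := z0_feasible.
rewrite /phi_CP /= H0 h0 L0 !is_norm0// !addr0.
have -> : Num.max 0 (gap P (zxy z0)) = 0.
  by apply/max_idPl; move: fV; rewrite /gap -(fineK Vfin) -EFinB lee_fin.
have -> : map_mx (Num.max 0) (G (zxy z0)) = 0.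
  by apply/rowP => i; rewrite !mxE; apply/max_idPl.
rewrite is_norm0// !add0r big1// => i _; apply: dist_Omega_eq0 => //.
have [gi ui gu] := feasible_complementarity z0_feasible i.
have sc (k : R) : (k%:M : 'M[R]_1) 0 0 = k by rewrite mxE eqxx mulr1n.
split=> [j|j|].
- by rewrite row_mxKl !ord1 sc oppr_ge0.
- by rewrite row_mxKr !ord1 sc.
- rewrite /dot big_ord1 row_mxKl row_mxKr !sc.
  by case: gu => ->; rewrite ?oppr0 ?mul0r ?mulr0.
Qed.

Hypotheses (H_C1 : C1 H) (g_C1 : C1 g) (h_C1 : C1 h).
Hypotheses (fy_C1 : C1 (grad_y f)) (gy_C1 : C1 (jac_y g)) (hy_C1 : C1 (jac_y h)).

Lemma CP_constr_C1 t : C1 (CP_constr P t).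
Proof. exact: has_C1_diff_C1 (CP_constr_C1_diff _ _ _ _ _ _ t). Qed.

Lemma near_norm_lt (a b : Z -> R) : differentiable a z0 -> differentiable b z0 ->
  `|a z0| < `|b z0| -> \forall z \near z0, `|a z| < `|b z|.
Proof.
move=> /differentiable_continuous ca /differentiable_continuous cb ab.
have FF : Filter (nbhs z0) by exact: nbhs_filter.
have : `|b z| - `|a z| @[z --> z0] --> `|b z0| - `|a z0|.
  by apply: (@cvgB _ _ _ (nbhs z0)); exact: (@cvg_norm _ _ _ (nbhs z0)).
move=> /cvgr_gt/(_ 0); rewrite subr_gt0 => /(_ ab).
by apply: filterS => z; rewrite subr_gt0.
Qed.

Let active := constr_seq [set: 'I_q + 'I_n + 'I_s]%SET (set_I P z0) (set_K P z0).

Lemma CP_constr_eq0 t : t \in active -> CP_constr P t z0 = 0.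
Proof.
have [_ [_ H0] h0 L0 _] := z0_feasible.
rewrite !mem_cat => /or3P[] /mapP[j + ->] /=.
- by case: j => [[j|j]|j] _ /=; rewrite ?H0 ?h0 ?L0 mxE.
- by rewrite mem_enum inE => /andP[/eqP -> _]; rewrite oppr0.
- by rewrite mem_enum inE => /andP[_ /eqP].
Qed.

(* Near [z0] the complementarity pair [(- g_i, u_i)] with [u_i > 0] at [z0] is at
   distance at least [c |g_i|] from [Omega], and symmetrically when [g_i < 0]. *)
Lemma near_constr_le_phi : exists2 C, 0 < C &
  \forall z \near z0, forall t, t \in active -> `|CP_constr P t z| <= C * phi z.
Proof.
have [cq cq0 cqP] := is_norm_lower (nu_norm q).
have [cn cn0 cnP] := is_norm_lower (nu_norm n).
have [cs cs0 csP] := is_norm_lower (nu_norm s).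
have [c2 c20 c2P] := is_norm_lower (nu_norm (1 + 1)).
(* The sum dominates each inverse norm constant, so one [C] serves all kinds of constraints. *)
pose C := cq^-1 + cn^-1 + cs^-1 + c2^-1.
have leC c z (x : R) : 0 < c -> c^-1 <= C -> c * x <= phi z -> x <= C * phi z.
  move=> c0 cC xphi; rewrite (le_trans (_ : _ <= c^-1 * phi z))//.
    by rewrite ler_pdivlMl.
  by rewrite ler_wpM2r// phi_CP_ge0.
have [iq inn ss i2] : [/\ 0 < cq^-1, 0 < cn^-1, 0 < cs^-1 & 0 < c2^-1].
  by split; rewrite invr_gt0.
have coord c k (w : 'rV[R]_k) j z : 0 < c -> c^-1 <= C ->
    (forall x : 'rV[R]_k, c * `|x| <= nu x) -> nu w <= phi z -> `|w 0 j| <= C * phi z.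
  move=> c0 cC cP wphi; apply: (leC c) => //.
  rewrite (le_trans _ wphi)// (le_trans _ (cP w))// ler_pM2l//.
  exact: coord_le_norm.
exists C; first by rewrite /C; lra.
have FF : Filter (nbhs z0) by exact: nbhs_filter.
apply: (@filter_forall _ _ _ (nbhs z0) FF) => t.
have [tI|tI] := boolP (t \in active); last by apply: nearW.
have dC t' : differentiable (CP_constr P t') z0 by exact: (CP_constr_C1 t').1.
have t0 := CP_constr_eq0 tI.
move: tI t0; rewrite !mem_cat => /or3P[] /mapP[j + ->].
- move=> _ _; apply: nearW => z _; have [pH ph pL _] := phi_CP_ge z.
  case: j => [[j|j]|j] /=.
  + by apply: (coord cq) => //; rewrite /C; lra.
  + by apply: (coord cn) => //; rewrite /C; lra.
  + by apply: (coord cs) => //; rewrite /C; lra.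
- rewrite mem_enum => jI g0.
  have : \forall z \near z0,
      `|CP_constr P (inl (inr j)) z| < `|CP_constr P (inr j) z|.
    apply: near_norm_lt => //; rewrite g0 normr0 normr_gt0.
    by move: jI; rewrite inE => /andP[_ /lt0r_neq0].
  apply: filterS => z /= gu _; apply: (leC c2) => //; first by rewrite /C; lra.
  have [_ _ _ /(_ j)] := phi_CP_ge z; apply: le_trans.
  have := dist_Omega_ge (- g (zxy z) 0 j) (zu z 0 j) c2P c20.
  by rewrite min_l// ltW.
- rewrite mem_enum => jK u0.
  have : \forall z \near z0,
      `|CP_constr P (inr j) z| < `|CP_constr P (inl (inr j)) z|.
    apply: near_norm_lt => //; rewrite u0 normr0 normr_gt0 /= oppr_eq0.
    by move: jK; rewrite inE => /andP[/ltr0_neq0].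
  apply: filterS => z /= gu _; apply: (leC c2) => //; first by rewrite /C; lra.
  have [_ _ _ /(_ j)] := phi_CP_ge z; apply: le_trans.
  have := dist_Omega_ge (- g (zxy z) 0 j) (zu z 0 j) c2P c20.
  by rewrite min_r// ltW.
Qed.

Hypothesis rank_J : \rank (Jstar P z0) = (d + s + m + n - #|set_K P z0|)%N.

Lemma phi_CP_error_bound :
  exists2 C, 0 < C & \forall z \near z0, `|z0 - z| <= C * phi z.
Proof.
have [C1 C10 eb] := injective_diff_error_bound (fun t => (CP_constr_C1 t).1 z0)
  (Jstar_injective_diff z0_feasible rank_J H_C1 g_C1 h_C1 fy_C1 gy_C1 hy_C1).
have [C2 C20 le_phi] := near_constr_le_phi.
(* Each of the [size active] constraints contributes at most [C2 * phi z]; the successor keeps the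
   constant positive if the list is empty. *)
exists (C1 * ((size active).+1%:R * C2)); first by rewrite !mulr_gt0.
have FF : Filter (nbhs z0) by exact: nbhs_filter.
apply: filterS2 eb le_phi => z eb le_phi.
rewrite distrC (le_trans eb)// -mulrA ler_pM2l//.
apply: (@le_trans _ _ (\sum_(t <- active) C2 * phi z)).
  rewrite big_seq [leRHS]big_seq; apply: ler_sum => t tI.
  by rewrite [X in _ - X]CP_constr_eq0// subr0 le_phi.
rewrite big_const_seq count_predT iter_addr_0 -[leRHS]mulrA mulr_natl mulrS.
by rewrite lerDr mulr_ge0 ?phi_CP_ge0// ltW.
Qed.

Lemma CP_exact_penalty : lipschitz_around F (zxy z0) ->
  value P (lsubmx (zxy z0)) \is a fin_num ->
  exists mu, 0 <= mu /\ \forall z \near z0,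
    F (zxy z0) + mu * phi z0 <= F (zxy z) + mu * phi z.
Proof.
move=> /lipschitz_aroundP[L [r [L0 r0 FL]]] Vfin.
have [C C0 eb] := phi_CP_error_bound.
(* Near [z0], [F] drops by at most [L |z0 - z| <= L C phi z], which this weight compensates since
   [phi z0 = 0]. *)
exists (L * C); split; first by rewrite mulr_ge0// ltW.
have FF : Filter (nbhs z0) by exact: nbhs_filter.
have zr : \forall z \near z0, `|z0 - z| < r.
  have /cvgrPdist_lt/(_ _ r0) : id z @[z --> z0] --> z0 by exact: cvg_id.
  by [].
apply: filterS2 zr eb => z zr eb.
have sub_le : `|zxy z0 - zxy z| <= `|z0 - z|.
  by rewrite /zxy -raddfB norm_lsubmx_le.
rewrite phi_CP_eq0// mulr0 addr0.
have := FL (zxy z0) (zxy z); rewrite subrr normr0.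
move=> /(_ r0 (le_lt_trans sub_le zr)) /ler_normlP[_ Fz].
rewrite -lerBlDl (le_trans Fz)// -mulrA ler_pM2l//.
exact: le_trans sub_le eb.
Qed.

End ExactPenalty.

Theorem theorem5p2 (R : realType) (d s m n p q : nat)
  (P : combined_program R d s m n p q)
  (F_lip : forall w, lipschitz_around (upF P) w)
  (G_C1 : C1 (upG P)) (H_C1 : C1 (upH P))
  (f_C1 : C1 (lowf P)) (g_C1 : C1 (lowg P)) (h_C1 : C1 (lowh P))
  (fy_C1 : C1 (grad_y (lowf P))) (gy_C1 : C1 (jac_y (lowg P)))
  (hy_C1 : C1 (jac_y (lowh P)))
  (nu : forall k, 'rV[R]_k -> R) (nu_norm : forall k, is_norm (nu k))
  (xs : 'rV[R]_d) (ys : 'rV[R]_s) (us : 'rV[R]_m) (vs : 'rV[R]_n) :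
  let zs := row_mx (row_mx xs ys) (row_mx us vs) in
  CP_local_solution P zs ->
  value_lipschitz_around P xs ->
  \rank (Jstar P zs) = (d + s + m + n - #|set_K P zs|)%N ->
  [/\ CP_RCPLD P zs,
      M_stationary P zs &
      exists mu : R, 0 <= mu /\
        \forall z \near zs,
          upF P (zxy zs) + mu * phi_CP P nu zs
            <= upF P (zxy z) + mu * phi_CP P nu z].
Proof.
move=> zs [zs_feasible _] V_lip rank_J.
have zxyE : zxy zs = row_mx xs ys by exact: row_mxKl.
have V_lip' : value_lipschitz_around P (lsubmx (zxy zs)) by rewrite zxyE row_mxKl.
split.
- exact: CP_RCPLD_of_rank.
- exact: CP_M_stationary.
- apply: CP_exact_penalty => //.
  by have [/nbhs_singleton] := V_lip'.
Qed.
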